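(* Let $\mathcal{H}_{1}$ denote the unit circle centered at the origin of $\mathbb{R}^2$, and let $\mathcal{U}$ be any unit shape, with fundamental measure $\Pi_{\mathcal{U}}$. Then $\pi\leq\Pi_{\mathcal{U}}$, and $\pi=\Pi_{\mathcal{U}}$ if and only if $\mathcal{U}\cong\mathcal{H}_{1}$.
   Context: A curve $[a,b]\to\mathbb{R}^2$, $t\mapsto(x(t),y(t))$, is nicely rectifiable if it is continuously differentiable on $[a,b]$ (one-sided derivatives at the endpoints) and $x'(t),y'(t)$ never vanish simultaneously; it is piecewise nice if it is continuous and there is a partition $a=a_0<a_1<\cdots<a_n=b$ such that its restriction to each $[a_{i-1},a_i]$ is nicely rectifiable. A shape $\mathcal{C}$ is a piecewise nice simple closed curve in the Euclidean plane $\mathbb{R}^2$; it is identified with its image. For a shape $\mathcal{C}$, the region $R(\mathcal{C})$ enclosed by $\mathcal{C}$ is the union of $\mathcal{C}$ and the bounded component of $\mathbb{R}^2\setminus\mathcal{C}$. The area is $A(\mathcal{C}) := \iint_{R(\mathcal{C})}1\,dx\,dy$. The perimeter is $P(\mathcal{C}) := \sum_{i=1}^n\int_{a_{i-1}}^{a_i}\sqrt{x_{\mathcal{C}}'(t)^2+y_{\mathcal{C}}'(t)^2}\,dt$ (where the subintervals correspond to the nicely rectifiable pieces), and the semiperimeter is $S(\mathcal{C}) := \tfrac12P(\mathcal{C})$. A rigid motion of $\mathbb{R}^2$ is a composition of a rotation about the origin, possibly followed by a reflection across a line through the origin, followed by a translation. Shapes $\mathcal{C},\mathcal{D}$ are congruent,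 $\mathcal{C}\cong\mathcal{D}$, if $\mathcal{D}=M(\mathcal{C})$ for some rigid motion $M$. A unit shape is a shape $\mathcal{U}$ with $A(\mathcal{U})=S(\mathcal{U})$; its fundamental measure is $\Pi_{\mathcal{U}}:=A(\mathcal{U})=S(\mathcal{U})$. *)

(* Defs.v *)
From HB Require Import structures.
From mathcomp Require Import all_boot all_order all_algebra.
From mathcomp Require Import all_classical all_reals all_analysis.
Set Implicit Arguments.
Unset Strict Implicit.
Unset Printing Implicit Defensive.
Import Order.TTheory GRing.Theory Num.Theory.
Import numFieldNormedType.Exports.
Local Open Scope classical_set_scope.
Local Open Scope ring_scope.

Section Curves.
Context {R : realType}.
Implicit Types (f : R -> R) (g : R -> R * R) (a b t : R).

Definition xcoord g : R -> R := fun t => (g t).1.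
Definition ycoord g : R -> R := fun t => (g t).2.

Definition diff_quotient f t : R -> R := fun s => (f s - f t) / (s - t).

(* The limit is taken inside [a, b], so it is the two-sided derivative at
   interior points and the one-sided derivatives at a and b. *)
Definition derivable_on a b f :=
  forall t, t \in `[a, b] -> cvg (diff_quotient f t s @[s --> within `[a, b] t^']).

Definition derivative_on a b f : R -> R :=
  fun t => lim (diff_quotient f t s @[s --> within `[a, b] t^']).

Definition continuously_differentiable_on a b f :=
  derivable_on a b f /\ {within `[a, b], continuous (derivative_on a b f)}.

Definition nicely_rectifiable a b g :=
  [/\ continuously_differentiable_on a b (xcoord g),
      continuously_differentiable_on a b (ycoord g) &
      forall t, t \in `[a, b] ->
        ~ (derivative_on a b (xcoord g) t = 0 /\
           derivative_on a b (ycoord g) t = 0)].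

(* Only the values p 0, ..., p n of p are relevant; a < b forces 0 < n. *)
Definition is_partition a b (n : nat) (p : nat -> R) :=
  [/\ p 0%N = a, p n = b & forall i, (i < n)%N -> p i < p i.+1].

Definition piecewise_nice a b n p g :=
  [/\ is_partition a b n p, {within `[a, b], continuous g} &
      forall i, (i < n)%N -> nicely_rectifiable (p i) (p i.+1) g].

Definition simple_closed a b g :=
  g a = g b /\ {in `[a, b[ &, injective g}.

End Curves.

Record plane_shape (R : realType) := PlaneShape {
  left_end : R;
  right_end : R;
  param : R -> R * R;
  npieces : nat;
  knot : nat -> R;
  plane_shape_lt : left_end < right_end;
  plane_shape_nice : piecewise_nice left_end right_end npieces knot param;
  plane_shape_simple_closed : simple_closed left_end right_end param }.

Section Shapes.
Context {R : realType}.
Implicit Types (C U : plane_shape R) (A B : set (R * R)).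

Definition curve C : set (R * R) := param C @` `[left_end C, right_end C].

(* By the Jordan curve theorem, the complement of the curve has exactly one
   bounded component, so the second set is that component. *)
Definition region C : set (R * R) :=
  curve C `|`
  [set p | (~` curve C) p /\ bounded_set (connected_component (~` curve C) p)].

Definition area C : R :=
  \int[(@lebesgue_measure R \x @lebesgue_measure R)%E]_(p in region C) 1.

Definition speed_on (a b : R) (g : R -> R * R) : R -> R := fun t =>
  Num.sqrt (derivative_on a b (xcoord g) t ^+ 2 +
            derivative_on a b (ycoord g) t ^+ 2).

Definition perimeter C : R :=
  \sum_(i < npieces C)
    \int[@lebesgue_measure R]_(t in `[knot C i, knot C i.+1])
      speed_on (knot C i) (knot C i.+1) (param C) t.

Definition semiperimeter C : R := perimeter C / 2.

Definition rotation (theta : R) (p : R * R) : R * R :=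
  (cos theta * p.1 - sin theta * p.2, sin theta * p.1 + cos theta * p.2).

(* Reflection across the line spanned by (cos phi, sin phi). *)
Definition reflection (phi : R) (p : R * R) : R * R :=
  (cos (2 * phi) * p.1 + sin (2 * phi) * p.2,
   sin (2 * phi) * p.1 - cos (2 * phi) * p.2).

Definition translation (v : R * R) (p : R * R) : R * R := p + v.

Definition rigid_motion (M : R * R -> R * R) :=
  exists theta v,
    M = translation v \o rotation theta \/
    exists phi, M = translation v \o reflection phi \o rotation theta.

Definition congruent A B := exists2 M, rigid_motion M & B = M @` A.

Definition unit_shape U := area U = semiperimeter U.

Definition fundamental_measure U : R := area U.

Definition unit_circle : set (R * R) := [set p | p.1 ^+ 2 + p.2 ^+ 2 = 1].

End Shapes.

Arguments unit_circle : clear implicits.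

(* Main.v *)
(** Let [K] be the curve, [L] its length, [U] the region and [A = pi r0^2] its
    area.

    For a closed polygon, the points lying in the disk of radius [r] around some
    vertex but not in the one around another vertex are dropped between two
    consecutive vertices, and the area of a disk minus its translate by [v] is
    at most [2 r |v|].  Refining inscribed polygons, the set of centers of the
    disks of radius [r] crossed by [K] (having points of [K] both inside and
    strictly outside) has area at most [2 r L]; this is an inequality form of
    Poincare's formula.

    If no disk of radius [r] lies in [U] and none contains [K], then every disk
    of radius [r] meeting [U] is crossed by [K], so the Brunn-Minkowski
    inequality for [U] and a disk gives [pi (r0 + r)^2 <= 2 r L], whence
    [L > 2 pi r0] when [r < r0].  Otherwise, as [K] does not fit in a disk of
    radius [r < r0] (by areas), [U] contains disks of all radii [r < r0], hence
    one of radius [r0]; comparing areas, its boundary circle is part of [K].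
    Counting the disks of small radius crossed by that circle gives
    [L >= 2 pi r0], and any further point of [K] makes the inequality strict.

    For a unit shape [L = 2 A], so [L >= 2 pi r0] reads [r0 >= 1]. *)

Require Import Defs.
From HB Require Import structures.
From mathcomp Require Import all_boot all_order all_algebra.
From mathcomp Require Import all_classical all_reals all_analysis.
From mathcomp Require Import measurable_realfun ring lra.
Set Implicit Arguments.
Unset Strict Implicit.
Unset Printing Implicit Defensive.
Import Order.TTheory GRing.Theory Num.Theory.
Import numFieldNormedType.Exports.
Local Open Scope classical_set_scope.
Local Open Scope ring_scope.

(** * The Euclidean plane *)

Section EuclideanPlane.
Context {R : realType}.
Implicit Types (p q c : R * R) (r : R).

Definition enorm p : R := Num.sqrt (p.1 ^+ 2 + p.2 ^+ 2).

Lemma enorm_ge0 p : 0 <= enorm p. Proof. exact: sqrtr_ge0. Qed.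

Lemma sqr_enorm p : enorm p ^+ 2 = p.1 ^+ 2 + p.2 ^+ 2.
Proof. by rewrite sqr_sqrtr// addr_ge0 ?sqr_ge0. Qed.

Lemma ler_enorm_sqr p r : 0 <= r -> (enorm p <= r) = (p.1 ^+ 2 + p.2 ^+ 2 <= r ^+ 2).
Proof. by move=> r0; rewrite -sqr_enorm ler_pXn2r// nnegrE// enorm_ge0. Qed.

Lemma ltr_enorm_sqr p r : 0 <= r -> (enorm p < r) = (p.1 ^+ 2 + p.2 ^+ 2 < r ^+ 2).
Proof. by move=> r0; rewrite -sqr_enorm ltr_pXn2r// nnegrE// enorm_ge0. Qed.

(** Lagrange's identity: the two sides differ by the square of [a * y - b * x]. *)
Lemma cauchy_schwarz2 (a b x y : R) :
  (a * x + b * y) ^+ 2 <= (a ^+ 2 + b ^+ 2) * (x ^+ 2 + y ^+ 2).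
Proof.
rewrite -subr_ge0 (_ : _ - _ = (a * y - b * x) ^+ 2) ?sqr_ge0//; ring.
Qed.

Lemma ler_dot_enorm p q : p.1 * q.1 + p.2 * q.2 <= enorm p * enorm q.
Proof.
apply: (le_trans (ler_norm _)); rewrite /enorm -sqrtrM ?addr_ge0 ?sqr_ge0//.
by rewrite -sqrtr_sqr ler_wsqrtr// cauchy_schwarz2.
Qed.

Lemma ler_enormD p q : enorm (p + q) <= enorm p + enorm q.
Proof.
rewrite ler_enorm_sqr ?addr_ge0 ?enorm_ge0//= [leRHS]sqrrD !sqr_enorm.
have := ler_dot_enorm p q; nra.
Qed.

Lemma enormZ (k : R) p : enorm (k * p.1, k * p.2) = `|k| * enorm p.
Proof. by rewrite /enorm/= !exprMn -mulrDr sqrtrM ?sqr_ge0// sqrtr_sqr. Qed.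

Lemma enormN p : enorm (- p) = enorm p.
Proof. by rewrite /enorm/= !sqrrN. Qed.

Lemma enorm_distC p q : enorm (p - q) = enorm (q - p).
Proof. by rewrite -opprB enormN. Qed.

Lemma ler_enorm_distD c p q : enorm (p - q) <= enorm (p - c) + enorm (c - q).
Proof. by rewrite (le_trans _ (ler_enormD _ _))// addrA subrK. Qed.

Lemma enorm0 : enorm 0 = 0.
Proof. by rewrite /enorm/= !expr0n/= addr0 sqrtr0. Qed.

Lemma enorm_eq0 p : (enorm p == 0) = (p == 0).
Proof.
case: p => x y; rewrite -sqrf_eq0 sqr_enorm/= paddr_eq0 ?sqr_ge0// !sqrf_eq0.
by rewrite -pair_eqE.
Qed.

Lemma continuous_enorm : continuous (enorm : R * R -> R).
Proof.
move=> p; apply: (@continuous_comp _ _ _ (fun p : R * R => p.1 ^+ 2 + p.2 ^+ 2) Num.sqrt).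
  by apply: cvgD; apply: cvgM; [exact: cvg_fst|exact: cvg_fst|
    exact: cvg_snd|exact: cvg_snd].
exact: sqrt_continuous.
Qed.

Definition disk c r : set (R * R) := [set p | enorm (p - c) < r].
Definition closed_disk c r : set (R * R) := [set p | enorm (p - c) <= r].

End EuclideanPlane.

(** * Measurability of open and closed sets of the plane *)

Section PlaneMeasure.
Context {R : realType}.
Local Notation mu := (@lebesgue_measure R).
Local Notation mu2 := (mu \x mu)%E.
Local Notation mR := (measurableTypeR R).

Lemma continuous_sub_enorm (c : R * R) : continuous (fun p : R * R => enorm (p - c)).
Proof.
move=> p; apply: (@continuous_comp _ _ _ (fun p : R * R => p - c) enorm).
  by apply: cvgB; [exact: cvg_id|exact: cvg_cst].
exact: continuous_enorm.
Qed.

Lemma open_disk (c : R * R) (r : R) : open (disk c r).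
Proof.
have := @open_comp _ _ (fun p : R * R => enorm (p - c)) [set x | x < r].
apply; last exact: open_lt.
by move=> x _; exact: continuous_sub_enorm.
Qed.

Lemma closed_closed_disk (c : R * R) (r : R) : closed (closed_disk c r).
Proof.
have := @closed_comp _ _ (fun p : R * R => enorm (p - c)) [set x | x <= r].
apply; last exact: closed_le.
by move=> x _; exact: continuous_sub_enorm.
Qed.

(** Measurability refers to the product sigma-algebra, so the open set is written as a countable
    union of open squares with rational centers and half-sides [1 / (n + 1)]. *)
Lemma open_measurable2 (A : set (R * R)) :
  open A -> measurable (A : set (mR * mR)).
Proof.
move=> oA.
pose B (z : rat * rat * nat) : set (mR * mR) :=
  `](ratr z.1.1 - z.2.+1%:R^-1), (ratr z.1.1 + z.2.+1%:R^-1)[%classic `*`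
  `](ratr z.1.2 - z.2.+1%:R^-1), (ratr z.1.2 + z.2.+1%:R^-1)[%classic.
have -> : A = \bigcup_(z in [set z | B z `<=` A]) B z.
  apply/seteqP; split; last by move=> p [z /= zA Bz]; exact: zA.
  move=> p Ap.
  have /nbhs_ballP[e /= e0 pe] : nbhs p A by exact: open_nbhs_nbhs.
  (* The bound [e / 2] leaves room for two steps: from [p] to the rational center, and from there to
     a point of the square. *)
  have [n ne] : exists n, n.+1%:R^-1 < e / 2.
    have [n ne] := ltr_add_invr (divr_gt0 e0 (ltr0Sn R 1)).
    by exists n; rewrite add0r in ne.
  have n0 : (0 : R) < n.+1%:R^-1 by rewrite invr_gt0.
  have lt_itv (x : R) : x - n.+1%:R^-1 < x + n.+1%:R^-1.
    by rewrite ltrD2l gtrN.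
  have swap (x y d : R) : x - d < y -> y < x + d -> y - d < x < y + d by lra.
  have near (x y z d : R) : d < e / 2 -> x - d < y -> y < x + d ->
    y - d < z -> z < y + d -> `|x - z| < e by rewrite ltr_norml; lra.
  have [q1 q1p] := rat_in_itvoo (lt_itv p.1).
  have [q2 q2p] := rat_in_itvoo (lt_itv p.2).
  move: q1p q2p; rewrite !in_itv/= => /andP[q11 q12] /andP[q21 q22].
  exists (q1, q2, n) => //=; last first.
    by split => /=; rewrite in_itv/=; exact: swap.
  move=> s [/=]; rewrite !in_itv/= => /andP[s11 s12] /andP[s21 s22].
  by apply: pe; split; [exact: (near _ _ _ _ ne q11)|exact: (near _ _ _ _ ne q21)].
rewrite bigcup_mkcond; apply: countable_bigcupT_measurable => [|z].
  exact: countableP.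
by case: ifP => // _; apply: measurableX; exact: measurable_itv.
Qed.

Lemma closed_measurable2 (A : set (R * R)) :
  closed A -> measurable (A : set (mR * mR)).
Proof.
move=> cA; rewrite -(setCK A); apply: measurableC.
by apply: open_measurable2; exact: closed_openC.
Qed.

End PlaneMeasure.

(** * Slicing plane Lebesgue measure *)

Section Slices.
Context {R : realType}.
Local Notation mu := (@lebesgue_measure R).
Local Notation mu2 := (mu \x mu)%E.
Local Notation mR := (measurableTypeR R).

(** The product measure integrates the measures of x-sections; its uniqueness on rectangles allows
    the other order of integration. *)
Lemma plane_measure_ysection (A : set (mR * mR)) : measurable A ->
  mu2 A = (\int[mu]_y mu (ysection A y))%E.
Proof.
move=> mA.
rewrite (@product_measure_unique _ _ _ _ _ mu mu (product_measure2 mu mu))//.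
by move=> B D mB mD; rewrite -product_measure2E.
Qed.

(** The pushforward by the translation agrees with [mu] on the intervals []x, y]], which determine
    the measure. *)
Lemma lebesgue_measure_translation (a : R) (A : set mR) : measurable A ->
  mu ((fun x => x + a) @^-1` A) = mu A.
Proof.
move=> mA; pose f : mR -> mR := fun x => x + a.
have mf : measurable_fun setT f by exact: measurable_funD.
pose f' : {mfun mR >-> mR} := HB.pack f (isMeasurableFun.Build _ _ _ _ f mf).
apply/esym; apply: (@lebesgue_measure_unique _ (pushforward mu f')) => //.
move=> _ [[x y]] _ <-; transitivity (mu `]x - a, y - a]%classic); last first.
  congr (mu _); apply/seteqP; split => z /=; rewrite !in_itv/= /f; lra.
by rewrite !lebesgue_measure_itv/= !lte_fin ltrBlDr subrK -!EFinB opprB addrA subrK.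
Qed.

Lemma measurable_shear (k : R) (E : set (mR * mR)) : measurable E ->
  measurable ((fun p : mR * mR => ((p.1 + k * p.2, p.2) : mR * mR)) @^-1` E).
Proof.
move=> mE; rewrite -[_ @^-1` _]setTI; apply: measurable_fun_pair => //.
by apply: measurable_funD => //; exact: measurable_funM.
Qed.

(** The horizontal slice at height [y] is merely translated by [k * y]. *)
Lemma plane_measure_shear (k : R) (E : set (mR * mR)) : measurable E ->
  mu2 ((fun p : mR * mR => ((p.1 + k * p.2, p.2) : mR * mR)) @^-1` E) = mu2 E.
Proof.
move=> mE; rewrite !plane_measure_ysection//; last exact: measurable_shear.
apply: eq_integral => y _.
rewrite -[RHS](@lebesgue_measure_translation (k * y)); last exact: measurable_ysection.
by congr (mu _); apply/seteqP; split => x /=; rewrite /ysection/= !inE.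
Qed.

Lemma measurable_swap (E : set (mR * mR)) : measurable E ->
  measurable ((fun p : mR * mR => ((p.2, p.1) : mR * mR)) @^-1` E).
Proof. by move=> mE; rewrite -[_ @^-1` _]setTI; exact: measurable_fun_pair. Qed.

Lemma plane_measure_swap (E : set (mR * mR)) : measurable E ->
  mu2 ((fun p : mR * mR => ((p.2, p.1) : mR * mR)) @^-1` E) = mu2 E.
Proof.
move=> mE; rewrite [RHS]plane_measure_ysection//.
Qed.

(** [S] lies in the segment of length [d] that starts at its infimum. *)
Lemma lebesgue_measure_diam (S : set mR) (d : R) : measurable S -> 0 <= d ->
  (forall x y, S x -> S y -> x <= y -> y <= x + d) -> (mu S <= d%:E)%E.
Proof.
move=> mS d0 Sd; have [->|/set0P[x0 Sx0]] := eqVneq S set0.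
  by rewrite measure0 lee_fin.
have lbS : lbound S (x0 - d).
  move=> y Sy; have [xy|/ltW yx] := leP x0 y; first by move: d0 xy; lra.
  by have := Sd _ _ Sy Sx0 yx; lra.
have hS : has_inf S by split; [exists x0|exists (x0 - d)].
have SI : S `<=` `[inf S, inf S + d]%classic.
  move=> y Sy /=; rewrite in_itv/= ge_inf//=; last by exists (x0 - d).
  rewrite -lerBlDr; apply: lb_le_inf; first by exists x0.
  move=> z Sz; rewrite lerBlDr; have [zy|/ltW yz] := leP z y; first exact: Sd.
  by move: yz d0; lra.
apply: (@le_trans _ _ (mu `[inf S, inf S + d]%classic)).
  by apply: le_measure => //; rewrite inE//; exact: measurable_itv.
rewrite lebesgue_measure_itv/= lte_fin; case: ifPn => _; last by rewrite lee_fin.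
by rewrite -EFinB lee_fin addrAC subrr add0r.
Qed.

(** Cavalieri's principle: the vertical slices have measure at most [d], over a base of length
    [u - l]. *)
Lemma plane_measure_le_slices (E : set (mR * mR)) (l u d : R) :
  measurable E -> 0 <= d -> l <= u ->
  (forall w x y, E (w, x) -> E (w, y) -> x <= y -> y <= x + d) ->
  (forall p, E p -> l <= p.1 <= u) ->
  (mu2 E <= (d * (u - l))%:E)%E.
Proof.
move=> mE d0 lu Ed Elu.
have {Elu} : E `<=` `[l, u]%classic `*` setT by move=> p /Elu; rewrite /= in_itv/=.
move=> Elu; apply: (@le_trans _ _ (\int[mu]_(w in `[l, u]) d%:E)%E); last first.
  rewrite integral_cst//= lebesgue_measure_itv/= lte_fin.
  move: lu; rewrite le_eqVlt => /predU1P[->|lu].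
    by rewrite ltxx subrr mulr0 mule0.
  by rewrite lu EFinM.
rewrite [leRHS]integral_mkcond; apply: ge0_le_integral => //=.
- exact: measurable_fun_xsection.
- by apply/(measurable_restrictT _ _).1 => //; exact: measurable_cst.
- move=> w _; rewrite patchE; case: ifPn => [_|].
    apply: lebesgue_measure_diam => //; first exact: measurable_xsection.
    by move=> x y; rewrite /xsection/= !inE; exact: Ed.
  move=> wlu; rewrite (_ : xsection E w = set0) ?measure0//.
  apply/seteqP; split => // y; rewrite /xsection/= inE => /Elu[/= wE _].
  by rewrite notin_setE in wlu.
Qed.

Lemma measurable_disk (c : R * R) (r : R) : measurable (disk c r : set (mR * mR)).
Proof. by apply: open_measurable2; exact: open_disk. Qed.

Lemma measurable_closed_disk (c : R * R) (r : R) :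
  measurable (closed_disk c r : set (mR * mR)).
Proof. by apply: closed_measurable2; exact: closed_closed_disk. Qed.

Lemma disk_convex (c p q : R * R) (r t : R) : 0 <= t <= 1 ->
  disk c r p -> disk c r q ->
  disk c r (p.1 + t * (q.1 - p.1), p.2 + t * (q.2 - p.2)).
Proof.
move=> /andP[t0 t1]; rewrite /disk/=.
rewrite (_ : (_, _) - c = ((1 - t) * (p - c).1, (1 - t) * (p - c).2) +
                    (t * (q - c).1, t * (q - c).2)); last first.
  by congr pair => /=; ring.
move=> pr qr; apply: (le_lt_trans (ler_enormD _ _)); rewrite !enormZ.
rewrite !ger0_norm//; last by lra.
have [->|tn0] := eqVneq t 0; first by lra.
have {tn0 t0}t0 : 0 < t by rewrite lt_neqAle eq_sym tn0.
nra.
Qed.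

(** A line parallel to [v = c' - c] meets the difference in a set of diameter at most [|v|], and the
    lines that meet the disk fill a strip of width [2 r]. A coordinate swap or a shear makes these
    lines vertical, which reduces the bound to vertical slices. *)
Lemma plane_measure_diskD (c c' : R * R) (r : R) : 0 <= r ->
  (mu2 (disk c r `\` disk c' r) <= (2 * r * enorm (c' - c))%:E)%E.
Proof.
move=> r0; have [v vE] : {v | v = c' - c} by exists (c' - c).
pose E : set (mR * mR) := disk c r `\` disk c' r.
have mE : measurable E by apply: measurableD; exact: measurable_disk.
have disk_v p : disk c' r p <-> disk c r (p - v).
  by rewrite /disk/= vE opprB addrA addrAC addrK.
(* If [t > 1], then [p + (t - 1) v] is on the segment from [p] to [p + t v], hence in the disk
   around [c]; translating by [v] puts [p + t v] in the disk around [c'], a contradiction. *)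
have gap p (t s : R) : E p -> E (p.1 + t * v.1, p.2 + t * v.2) -> 0 <= t -> t <= 1.
  move=> [pc pc'] [qc qc'] t0; rewrite leNgt; apply/negP => t1.
  apply: qc'; apply/disk_v.
  have tn0 : t != 0 by rewrite gt_eqF// (lt_trans _ t1).
  have -> : (p.1 + t * v.1, p.2 + t * v.2) - v =
      (p.1 + (t - 1) / t * (p.1 + t * v.1 - p.1),
       p.2 + (t - 1) / t * (p.2 + t * v.2 - p.2)).
    by congr pair => /=; field.
  apply: (disk_convex _ pc qc); rewrite divr_ge0 ?subr_ge0 ?(ltW t1)//=.
  by rewrite ler_pdivrMr ?mul1r ?gerBl// (lt_trans _ t1).
have gapN p q t : E p -> E q -> q = (p.1 + t * v.1, p.2 + t * v.2) -> `|t| <= 1.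
  move=> Ep Eq qE; have [t0|/ltW t0] := leP 0 t.
    by rewrite ger0_norm//; apply: (gap p) => //; rewrite -qE.
  rewrite ler0_norm//; apply: (gap q); rewrite ?oppr_ge0// (_ : (_, _) = p)//.
  by rewrite qE; case: (p) => a b; congr pair => /=; ring.
have gapZ (x y a : R) : a != 0 -> `|(y - x) / a| <= 1 -> y <= x + `|a|.
  move=> a0; rewrite normrM normfV ler_pdivrMr ?normr_gt0// mul1r => yx.
  by rewrite -lerBlDl (le_trans _ yx)// ler_norm.
have [v20|v20] := eqVneq v.2 0.
  have [v10|v10] := eqVneq v.1 0.
    rewrite (_ : _ `\` _ = set0) ?measure0 ?lee_fin ?mulr_ge0 ?enorm_ge0//.
    have v0 : v = 0 by case: (v) v10 v20 => a b /= -> ->.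
    by apply/seteqP; split => // p [pc]; apply; apply/disk_v; rewrite v0 subr0.
  rewrite -/E -plane_measure_swap//.
  apply: (@le_trans _ _ (`|v.1| * (c.2 + r - (c.2 - r)))%:E).
    apply: plane_measure_le_slices => //.
    - exact: measurable_swap.
    - by lra.
    - move=> w x y Ex Ey xy; apply: gapZ => //; apply: (gapN _ _ _ Ex Ey) => /=.
      by rewrite v20 mulr0 addr0 divfK//; congr pair; ring.
    - move=> [w x] [/= pc _].
      have : `|w - c.2| <= r.
        rewrite -sqrtr_sqr (le_trans _ (ltW pc))// ler_wsqrtr//= lerDr.
        exact: sqr_ge0.
      by rewrite ler_norml; lra.
  rewrite lee_fin -vE /enorm v20 expr0n/= addr0 sqrtr_sqr.
  by rewrite (_ : `|v.1| * _ = 2 * r * `|v.1|)//; ring.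
pose k := v.1 / v.2.
rewrite -/E -(plane_measure_shear k)//; pose m := c.1 - k * c.2.
apply: (@le_trans _ _ (`|v.2| * (m + enorm (k, 1) * r - (m - enorm (k, 1) * r)))%:E).
  apply: plane_measure_le_slices => //.
  - exact: measurable_shear.
  - by have := mulr_ge0 (enorm_ge0 (k, 1)) r0; lra.
  - move=> w x y Ex Ey xy; apply: gapZ => //; apply: (gapN _ _ _ Ex Ey) => /=.
    by rewrite /k; congr pair; field.
  - move=> [w y] [/= pc _].
    (* [w - m] is the scalar product of [(1, - k)] with the vector from [c] to the sheared point,
       whose length is below [r]. *)
    have : `|w - m| <= enorm (k, 1) * r.
      apply: (@le_trans _ _ (enorm (k, 1) * enorm ((w + k * y, y) - c))); last first.
        by rewrite ler_wpM2l ?enorm_ge0// ltW.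
      rewrite (_ : enorm (k, 1) = enorm (1, - k)); last first.
        by rewrite /enorm/= sqrrN addrC.
      rewrite (_ : w - m = 1 * (w + k * y - c.1) + (- k) * (y - c.2)); last first.
        by rewrite /m; ring.
      rewrite ler_norml; apply/andP; split; last exact: (ler_dot_enorm (1, - k) (_, _)).
      rewrite lerNl -[in leRHS]enormN.
      apply: le_trans (ler_dot_enorm _ _) => /=.
      by rewrite le_eqVlt; apply/orP; left; apply/eqP; ring.
    by rewrite ler_norml; lra.
rewrite lee_fin -vE (_ : enorm v = `|v.2| * enorm (k, 1)).
  by rewrite le_eqVlt; apply/orP; left; apply/eqP; ring.
rewrite -enormZ mulr1 /k mulrC divfK//; by case: (v).
Qed.

End Slices.

(** * The area of a disk *)

Section DiskArea.
Context {R : realType}.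
Local Notation mu := (@lebesgue_measure R).
Local Notation mu2 := (mu \x mu)%E.
Local Notation mR := (measurableTypeR R).

Lemma derivable_LRcontinuous (f F : R -> R) (a b : R) :
  (forall x : R, is_derive x 1 F (f x)) -> derivable_oo_LRcontinuous F a b.
Proof.
move=> dF; have cF : continuous F.
  by move=> x; apply/differentiable_continuous/derivable1_diffP/ex_derive.
split; [by move=> x _; exact: ex_derive|exact/cvg_at_right_filter/cF|
  exact/cvg_at_left_filter/cF].
Qed.

Lemma integral_derivative (f F : R -> R) (a b : R) : a < b -> continuous f ->
  (forall x : R, is_derive x 1 F (f x)) ->
  (\int[mu]_(x in `[a, b]) (f x)%:E = (F b - F a)%:E)%E.
Proof.
move=> ab cf dF; rewrite EFinB; apply: continuous_FTC2 => //.
- exact: continuous_subspaceT.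
- exact: derivable_LRcontinuous dF.
- by move=> x _; rewrite derive1E derive_val.
Qed.

Lemma continuous_semicircle (c r : R) :
  continuous (fun x => Num.sqrt (r ^+ 2 - (x - c) ^+ 2)).
Proof.
move=> x; apply: (@continuous_comp _ _ _ (fun x => r ^+ 2 - (x - c) ^+ 2)) => /=.
  apply: cvgB; first exact: cvg_cst.
  by apply: cvgM; apply: cvgB; by [exact: cvg_id|exact: cvg_cst].
exact: sqrt_continuous.
Qed.

(** Substituting [x = c + r sin t] turns the integrand into [r^2 cos^2 t], which has the primitive
    [H]. The free bounds serve both a half disk and a quarter disk. *)
Lemma integral_semicircle (c r u v : R) : 0 < r -> u < v ->
  u \in `[- (pi / 2), pi / 2] -> v \in `[- (pi / 2), pi / 2] ->
  (\int[mu]_(x in `[(c + r * sin u)%R, (c + r * sin v)%R])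
     (Num.sqrt (r ^+ 2 - (x - c) ^+ 2))%:E =
   (r ^+ 2 / 2 * ((v - u) + (sin v * cos v - sin u * cos u)))%:E)%E.
Proof.
move=> r0 uv ui vi; pose F (t : R) := c + r * sin t.
have uvi t : t \in `[u, v] -> t \in `[- (pi / 2), pi / 2].
  move: ui vi; rewrite !in_itv/= => /andP[? ?] /andP[? ?] /andP[? ?].
  by apply/andP; split; lra.
have dF (t : R) : is_derive t 1 F (r * cos t).
  by apply: is_derive_eq; rewrite /GRing.scale/=; ring.
have F'E : F^`()%classic = (fun t => r * cos t).
  by apply/funext => t; rewrite derive1E derive_val.
have cF' : continuous F^`()%classic.
  by rewrite F'E => t; apply: cvgM; [exact: cvg_cst|exact: continuous_cos].
rewrite (@integration_by_substitution_increasing _ F)//; first last.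
- by apply: continuous_subspaceT; exact: continuous_semicircle.
- exact: derivable_LRcontinuous dF.
- apply/cvg_ex; exists (F^`()%classic v); apply: cvg_at_left_filter; exact: cF'.
- apply/cvg_ex; exists (F^`()%classic u); apply: cvg_at_right_filter; exact: cF'.
- move=> x y /uvi xi /uvi yi xy; rewrite /F ltrD2l ltr_pM2l// ltr_sin//.
- exact: ltW.
pose H (t : R) := r ^+ 2 / 2 * (t + sin t * cos t).
transitivity (\int[mu]_(x in `[u, v]) (r ^+ 2 * cos x ^+ 2)%:E)%E.
  apply: eq_integral => t /[!inE]/= /uvi ti; congr EFin.
  rewrite F'E; transitivity (Num.sqrt (r ^+ 2 - (F t - c) ^+ 2) * (r * cos t)) => //.
  rewrite (_ : F t - c = r * sin t); last by rewrite /F; ring.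
  rewrite exprMn -{1}[r ^+ 2]mulr1 -mulrBr -cos2sin2.
  rewrite -exprMn sqrtr_sqr ger0_norm; first by ring.
  by rewrite mulr_ge0 ?(ltW r0)// cos_ge0_pihalf//; rewrite in_itv in ti.
have dH (t : R) : is_derive t 1 H (r ^+ 2 * cos t ^+ 2).
  apply: is_derive_eq; rewrite /GRing.scale/=.
  have := cos2Dsin2 t; move: (sin t) (cos t) => s k sk.
  have -> : r ^+ 2 * k ^+ 2 = r ^+ 2 / 2 * (k ^+ 2 + (k ^+ 2 + s ^+ 2) - s ^+ 2).
    by field.
  by rewrite sk; ring.
rewrite (integral_derivative uv _ dH).
  by rewrite /H; congr EFin; ring.
by move=> t; apply: cvgM; [exact: cvg_cst|apply: cvgM; exact: continuous_cos].
Qed.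

Lemma xsection_disk (c : R * R) (r x : R) : xsection (disk c r) x =
  if `|x - c.1| < r then `](c.2 - Num.sqrt (r ^+ 2 - (x - c.1) ^+ 2)),
                           (c.2 + Num.sqrt (r ^+ 2 - (x - c.1) ^+ 2))[%classic
  else set0.
Proof.
apply/seteqP; split => y; rewrite /xsection/= inE /disk/=.
  move=> xy; have r0 : 0 < r by exact: le_lt_trans (enorm_ge0 _) xy.
  have xr : `|x - c.1| < r.
    by rewrite (le_lt_trans _ xy)// -sqrtr_sqr ler_wsqrtr//= lerDl sqr_ge0.
  rewrite xr/= in_itv/=; move: xy; rewrite ltr_enorm_sqr ?(ltW r0)//= => xy.
  rewrite -ltr_distl -sqrtr_sqr ltr_sqrt; first by move: xy; lra.
  rewrite subr_gt0 -real_normK ?num_real// ltr_pXn2r// nnegrE//; exact: ltW.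
case: ifPn => // xr; rewrite /= in_itv/= -ltr_distl => yr.
have r0 : 0 < r by exact: le_lt_trans (normr_ge0 _) xr.
move: yr; rewrite -sqrtr_sqr ltr_sqrt; last first.
  by rewrite subr_gt0 -real_normK ?num_real// ltr_pXn2r// nnegrE//; exact: ltW.
by rewrite ltr_enorm_sqr ?(ltW r0)//=; lra.
Qed.

Lemma plane_measure_disk (c : R * R) (r : R) : 0 <= r ->
  mu2 (disk c r) = (pi * r ^+ 2)%:E.
Proof.
rewrite le_eqVlt => /predU1P[<-|r0].
  rewrite expr0n/= mulr0 (_ : disk c 0 = set0) ?measure0//.
  by apply/seteqP; split => // p; rewrite /disk/= ltNge enorm_ge0.
transitivity (\int[mu]_(x in `[(c.1 + r * sin (- (pi / 2)))%R, (c.1 + r * sin (pi / 2))%R])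
   (2 * Num.sqrt (r ^+ 2 - (x - c.1) ^+ 2))%:E)%E.
  rewrite [RHS]integral_mkcond; apply: eq_integral => x _.
  rewrite [LHS]/= xsection_disk patchE sinN sin_pihalf mulrN mulr1.
  have xE : (x \in `[c.1 - r, c.1 + r]%classic) = (`|x - c.1| <= r).
    by rewrite mem_setE in_itv/= ler_distl.
  rewrite xE; case: ifPn => xr.
    rewrite (ltW xr) lebesgue_measure_itv/= lte_fin.
    have s0 := sqrtr_ge0 (r ^+ 2 - (x - c.1) ^+ 2).
    case: ifPn => [_|]; first by rewrite -EFinB; congr EFin; ring.
    by rewrite -leNgt => s1; congr EFin; apply/eqP; rewrite eq_le; apply/andP; split; lra.
  (* There remains [|x - c.1| = r], where the slice is empty and the integrand vanishes. *)
  case: ifPn => xr'; last by rewrite measure0.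
  have -> : (x - c.1) ^+ 2 = r ^+ 2.
    rewrite -[LHS]real_normK ?num_real//; congr (_ ^+ 2).
    by apply/eqP; rewrite eq_le xr' leNgt.
  by rewrite measure0 subrr sqrtr0 mulr0.
have pi0 : 0 < pi / 2 :> R by rewrite divr_gt0// pi_gt0.
under eq_integral do rewrite EFinM.
rewrite ge0_integralZl//=; last first.
  apply: measurable_funTS; apply/measurable_EFinP.
  by apply: continuous_measurable_fun; exact: continuous_semicircle.
rewrite integral_semicircle//.
- rewrite sinN cosN sin_pihalf cos_pihalf !mulr0 subrr addr0 -EFinM; congr EFin.
  by field.
- lra.
- by rewrite in_itv/= lexx/=; lra.
- by rewrite in_itv/= lexx andbT; lra.
Qed.

(** The closed disk lies in every open disk of radius [r + d], and [d] can be taken arbitrarily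
    small. *)
Lemma plane_measure_closed_disk_le (c : R * R) (r : R) : 0 <= r ->
  (mu2 (closed_disk c r) <= (pi * r ^+ 2)%:E)%E.
Proof.
move=> r0; apply/lee_addgt0Pr => e e0.
have [d /andP[d0 d1] de] : exists2 d : R, 0 < d <= 1 &
    pi * (r + d) ^+ 2 <= pi * r ^+ 2 + e.
  have p0 : 0 < pi * (2 * r + 1) :> R by rewrite mulr_gt0 ?pi_gt0//; lra.
  (* For [d <= 1], the added area [pi (2 r d + d^2)] is at most [d pi (2 r + 1)]. *)
  exists (Num.min 1 (e / (pi * (2 * r + 1)))).
    by rewrite lt_min ltr01 divr_gt0//= ge_min lexx.
  set d := Num.min _ _; have d1 : d <= 1 by rewrite /d ge_min lexx.
  have d0 : 0 < d by rewrite lt_min ltr01 divr_gt0.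
  have : d * (pi * (2 * r + 1)) <= e by rewrite -ler_pdivlMr// ge_min lexx orbT.
  have := pi_gt0 R; nra.
rewrite -EFinD; apply: (@le_trans _ _ (mu2 (disk c (r + d)))).
  apply: le_measure; rewrite ?inE; [exact: measurable_closed_disk|exact: measurable_disk|].
  by move=> p; rewrite /closed_disk/disk/= => pr; rewrite (le_lt_trans pr)// ltrDl.
by rewrite plane_measure_disk ?lee_fin// addr_ge0// ltW.
Qed.

End DiskArea.

(** * The Brunn-Minkowski inequality with a disk *)

Section BrunnMinkowski.
Context {R : realType}.
Local Notation mu := (@lebesgue_measure R).
Local Notation mu2 := (mu \x mu)%E.
Local Notation mR := (measurableTypeR R).

(** [T] contains [S] and two intervals of length [s], one just below the infimum of [S] and one just
    above its supremum. This is the Brunn-Minkowski inequality on the line for a set and an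
    interval. *)
Lemma lebesgue_measure_thickening (S T : set mR) (s M : R) :
  measurable S -> measurable T -> 0 < s -> S !=set0 ->
  (forall x, S x -> `|x| <= M) ->
  (forall x y, S x -> `|y - x| < s -> T y) ->
  (mu S + (2 * s)%:E <= mu T)%E.
Proof.
move=> mS mT s0 Sn0 SM ST.
have ubS : has_ubound S by exists M => x /SM; rewrite ler_norml => /andP[].
have lbS : has_lbound S by exists (- M) => x /SM; rewrite ler_norml => /andP[].
have hs : has_sup S by [].
have hi : has_inf S by [].
pose I1 : set mR := `](inf S - s), (inf S)[%classic.
pose I2 : set mR := `](sup S), (sup S + s)[%classic.
have muI1 : mu I1 = s%:E.
  rewrite lebesgue_measure_itv/= lte_fin ltrBlDr ltrDl s0 -EFinB; congr EFin; ring.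
have muI2 : mu I2 = s%:E.
  rewrite lebesgue_measure_itv/= lte_fin ltrDl s0 -EFinB; congr EFin; ring.
have mI1 : measurable I1 by exact: measurable_itv.
have mI2 : measurable I2 by exact: measurable_itv.
have SI1 : [disjoint S & I1].
  apply/disj_setPS => x [Sx]; rewrite /I1/= in_itv/= => /andP[_].
  by rewrite ltNge ge_inf.
have SI2 : [disjoint S `|` I1 & I2].
  apply/disj_setPS => x [SIx]; rewrite /I2/= in_itv/= => /andP[+ _].
  case: SIx => [Sx|]; first by rewrite ltNge ub_le_sup.
  rewrite /I1/= in_itv/= => /andP[_ xi] sx; have := lt_trans sx xi.
  by case: Sn0 => y Sy; rewrite ltNge (le_trans (ge_inf lbS Sy))// ub_le_sup.
have -> : (mu S + (2 * s)%:E = mu (S `|` I1 `|` I2))%E.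
  transitivity (mu S + mu I1 + mu I2)%E.
    by rewrite muI1 muI2 -addeA -EFinD; congr (_ + _%:E)%E; ring.
  rewrite measureU//; [|exact: measurableU|exact/disj_set2P].
  by rewrite measureU//; exact/disj_set2P.
apply: le_measure; rewrite ?inE//; first by do 2 apply: measurableU => //.
move=> x [[Sx|]|].
- by apply: (ST x) => //; rewrite subrr normr0.
- rewrite /I1/= in_itv/= => /andP[xi1 xi2].
  have [y Sy yx] : exists2 y, S y & y < x + s.
    by apply: inf_lt => //; rewrite -ltrBlDr.
  apply: (ST y) => //; have := ge_inf lbS Sy.
  by rewrite ltr_norml; lra.
- rewrite /I2/= in_itv/= => /andP[xi1 xi2].
  have [y Sy yx] : exists2 y, S y & x - s < y.
    by apply: sup_gt => //; rewrite ltrBlDr.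
  apply: (ST y) => //; have := ub_le_sup ubS Sy.
  by rewrite ltr_norml; lra.
Qed.

(** * Superlevel sets stacked in the plane *)

Section Layers.
Variables (f : mR -> \bar R) (k r : R).
Hypotheses (mf : measurable_fun setT f) (k0 : 0 < k).

(** The slice at abscissa [t] is the superlevel set of [f] at level [k t], so that functions with
    different ranges can be compared over the same segment [[0, r]]. *)
Definition layers : set (mR * mR) :=
  [set p | 0 <= p.1 <= r /\ ((k * p.1)%:E < f p.2)%E].

Lemma measurable_layers : measurable layers.
Proof.
rewrite (_ : layers = (`[0, r]%classic `*` setT) `&`
    [set p | ((k * p.1)%:E < f p.2)%E]).
  apply: measurable_lte => //.
  - by apply: measurableX => //; exact: measurable_itv.
  - apply: measurable_funTS; apply/measurable_EFinP.
    by apply: measurable_funM => //; exact: measurable_fst.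
  - by apply: measurable_funTS; apply: measurableT_comp.
by apply/seteqP; split => p; rewrite /layers/= in_itv/= => -[]; do ?case.
Qed.

(** For fixed [x], the admissible [t] form the interval [[0, f x / k[] cut off at [r]. *)
Lemma plane_measure_layers_le : (forall x, 0 <= f x)%E ->
  (mu2 layers <= k^-1%:E * \int[mu]_x f x)%E.
Proof.
move=> f0; rewrite plane_measure_ysection; last exact: measurable_layers.
rewrite -ge0_integralZl//; last by rewrite lee_fin invr_ge0 ltW.
apply: ge0_le_integral => //=.
- by apply: measurable_fun_ysection; exact: measurable_layers.
- exact: measurable_funeM.
move=> x _; have := f0 x; case fx : (f x) => [y| |]// y0; last first.
  by rewrite gt0_muley ?leey// lte_fin invr_gt0.
apply: (@le_trans _ _ (mu `[0, k^-1 * y]%classic)).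
  apply: le_measure; rewrite ?inE.
  - by apply: measurable_ysection; exact: measurable_layers.
  - exact: measurable_itv.
  move=> t; rewrite /ysection/= inE /layers/= fx lte_fin in_itv/= => -[/andP[-> _] /ltW].
  by rewrite ler_pdivlMl.
by rewrite lebesgue_measure_itv/= lte_fin; case: ifPn => _;
  rewrite ?sube0// lee_fin mulr_ge0 ?invr_ge0 ?(ltW k0).
Qed.

(** When [f] stays below [k r], the cut-off at [r] removes nothing from the intervals [[0, f x /
    k[]. *)
Lemma plane_measure_layers_ge : (forall x, 0 <= f x)%E ->
  (forall x, f x <= (k * r)%:E)%E ->
  (k^-1%:E * \int[mu]_x f x <= mu2 layers)%E.
Proof.
move=> f0 fkr; rewrite plane_measure_ysection; last exact: measurable_layers.
rewrite -ge0_integralZl//; last by rewrite lee_fin invr_ge0 ltW.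
apply: ge0_le_integral => //=.
- by move=> x _; rewrite mule_ge0// lee_fin invr_ge0 ltW.
- exact: measurable_funeM.
- by apply: measurable_fun_ysection; exact: measurable_layers.
move=> x _; have := f0 x; have := fkr x; case fx : (f x) => [y| |]//.
rewrite !lee_fin => ykr y0.
apply: (@le_trans _ _ (mu `[0, k^-1 * y[%classic)).
  rewrite lebesgue_measure_itv/= lte_fin; case: ifPn => [_|]; first by rewrite sube0.
  by rewrite -leNgt -EFinM lee_fin.
apply: le_measure; rewrite ?inE.
- exact: measurable_itv.
- by apply: measurable_ysection; exact: measurable_layers.
move=> t; rewrite /ysection/= inE /layers/= fx lte_fin in_itv/= => /andP[-> tky].
have ky : k * t < y by rewrite -ltr_pdivlMl.
split=> //=; rewrite -(ler_pM2l k0); exact: le_trans (ltW ky) ykr.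
Qed.

End Layers.

(** Let [a] and [c] be the slice lengths of [E] and [N], and [alpha] the supremum of [a]. With
    [k = alpha / r], the set where [c > (k + 2) t] contains the thickening by [sqrt (r^2 - t^2)] of
    the set where [a > k t]. Applying the inequality on the line to these level sets and integrating
    over [t] in [[0, r]] gives [|N| / (k + 2) >= |E| / k + pi r^2 / 2], which implies the claim. *)
Lemma plane_measure_thickening (E N : set (mR * mR)) (M r r0 : R) :
  measurable E -> measurable N -> 0 < r -> 0 < r0 ->
  (forall p, E p -> `|p.1| <= M /\ `|p.2| <= M) ->
  (forall p, E p -> disk p r `<=` N) ->
  mu2 E = (pi * r0 ^+ 2)%:E -> ((pi * (r0 + r) ^+ 2)%:E <= mu2 N)%E.
Proof.
move=> mE mN r_gt0 r0_gt0 EM EN muE.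
pose a (x : mR) : \bar R := mu (xsection E x).
pose c (x : mR) : \bar R := mu (xsection N x).
have ma : measurable_fun setT a by exact: measurable_fun_xsection.
have mc : measurable_fun setT c by exact: measurable_fun_xsection.
have a0 x : (0 <= a x)%E by exact: measure_ge0.
have c0 x : (0 <= c x)%E by exact: measure_ge0.
have aM x : (a x <= `|2 * M|%:E)%E.
  apply: (@le_trans _ _ (mu `[- M, M]%classic)).
    apply: le_measure; rewrite ?inE; [exact: measurable_xsection|exact: measurable_itv|].
    by move=> y; rewrite /xsection/= inE in_itv/= -ler_norml => /EM[].
  rewrite lebesgue_measure_itv/=; case: ifPn => _; last by rewrite lee_fin.
  by rewrite -EFinB lee_fin opprK (le_trans _ (ler_norm _))// mulr_natl mulr2n.
have aE x : a x = (fine (a x))%:E.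
  by rewrite fineK// ge0_fin_numE// (le_lt_trans (aM x)) ?ltry.
pose alpha : R := sup (range (fine \o a)).
have has_sup_a : has_sup (range (fine \o a)).
  split; first by exists (fine (a 0)), 0.
  by exists `|2 * M| => _ [x _ <-]; rewrite /= -lee_fin -aE.
have a_alpha x : (a x <= alpha%:E)%E.
  rewrite aE lee_fin; apply: ub_le_sup; first by case: has_sup_a.
  by exists x.
have mu2E : mu2 E = (\int[mu]_x a x)%E by [].
have alpha0 : 0 < alpha.
  rewrite ltNge; apply/negP => alpha0.
  have : mu2 E = 0%E.
    rewrite mu2E; apply: integral0_eq => x _; apply/eqP.
    by rewrite eq_le a0 andbT (le_trans (a_alpha x)).
  by apply/eqP; rewrite muE eqe gt_eqF// mulr_gt0 ?pi_gt0// exprn_gt0.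
(* With this ratio the levels [k t] sweep exactly the range [[0, alpha]] as [t] runs over
   [[0, r]]. *)
pose k := alpha / r; have k0 : 0 < k by rewrite divr_gt0.
have kr : k * r = alpha by rewrite divfK// gt_eqF.
have k20 : 0 < k + 2 by rewrite addr_gt0.
pose s (t : R) := Num.sqrt (r ^+ 2 - (t - 0) ^+ 2).
have slice t : 0 <= t <= r ->
  (mu (xsection (layers a k r) t) + (2 * s t)%:E <=
   mu (xsection (layers c (k + 2) r) t))%E.
  (* At [t = r] the level is [alpha] itself, and the superlevel set of [a] is empty. *)
  move=> /andP[t0]; rewrite le_eqVlt => /predU1P[->|tr].
    rewrite /s subr0 subrr sqrtr0 mulr0 adde0.
    rewrite (_ : xsection _ _ = set0) ?measure0 ?measure_ge0//.
    apply/seteqP; split=> // x; rewrite /xsection/= inE /layers/= kr => -[_].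
    by rewrite ltNge a_alpha.
  have t_in : 0 <= t <= r by rewrite t0 ltW.
  have lt_sqr (u v : R) : 0 <= v -> `|u| < v -> 0 < v ^+ 2 - u ^+ 2.
    by move=> v0 uv; rewrite subr_gt0 -real_normK ?num_real// ltr_pXn2r// nnegrE.
  have st0 : 0 < s t by rewrite sqrtr_gt0 subr0 lt_sqr ?(ltW r_gt0)// ger0_norm.
  have inS x : xsection (layers a k r) t x = ((k * t)%:E < a x)%E.
    by rewrite /xsection/= in_setE /layers/= t_in; apply/propext; split => // -[].
  have inT x : xsection (layers c (k + 2) r) t x = (((k + 2) * t)%:E < c x)%E.
    by rewrite /xsection/= in_setE /layers/= t_in; apply/propext; split => // -[].
  have section_neq0 x : ((k * t)%:E < a x)%E -> exists y, E (x, y).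
    move=> ax; have /set0P[y] : xsection E x != set0.
      apply/eqP => E0; move: ax; rewrite /a E0 measure0 lte_fin ltNge.
      by rewrite mulr_ge0// ltW.
    by rewrite /xsection/= inE; exists y.
  apply: (@lebesgue_measure_thickening _ _ _ M) => //.
  - by apply: measurable_xsection; exact: measurable_layers.
  - by apply: measurable_xsection; exact: measurable_layers.
  - have [||_ [x _ <-] /= kx] := @sup_gt _ (range (fine \o a)) (k * t).
    + by case: has_sup_a.
    + by rewrite -/alpha -kr ltr_pM2l.
    by exists x; rewrite inS aE lte_fin.
  - by move=> x; rewrite inS => /section_neq0[y /EM[]].
  (* As [|y - x| < s t], the slice of [N] at [y] contains the slice of [E] at [x] thickened by
     [sqrt (r^2 - (y - x)^2) > t], whence [c y > k t + 2 t]. *)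
  - move=> x y; rewrite inS inT => kx xy; have [z xz] := section_neq0 x kx.
    have yxr : `|y - x| ^+ 2 < r ^+ 2 - t ^+ 2.
      rewrite -[ltRHS]sqr_sqrtr; last by rewrite ltW// lt_sqr ?ger0_norm// ltW.
      by rewrite -[X in Num.sqrt (_ - X ^+ 2)]subr0 ltr_pXn2r// nnegrE.
    have ts : t < Num.sqrt (r ^+ 2 - (y - x) ^+ 2).
      rewrite -[ltLHS](ger0_norm t0) -sqrtr_sqr ltr_sqrt.
        by move: yxr; rewrite real_normK ?num_real//; lra.
      by move: yxr; rewrite real_normK ?num_real//; have := sqr_ge0 t; lra.
    have := @lebesgue_measure_thickening (xsection E x) (xsection N y)
      (Num.sqrt (r ^+ 2 - (y - x) ^+ 2)) M.
    rewrite -/(a x) -/(c y) => /(_ _ _ _ _ _ _)/(lt_le_trans _); apply.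
    + rewrite aE -EFinD lte_fin; move: kx; rewrite aE lte_fin; lra.
    + exact: measurable_xsection.
    + exact: measurable_xsection.
    + exact: le_lt_trans ts.
    + by exists z; rewrite /xsection/= inE.
    + by move=> w; rewrite /xsection/= inE => /EM[].
    + move=> w u; rewrite /xsection/= !inE => Ew wu; apply: (EN _ Ew).
      rewrite /disk/= ltr_enorm_sqr ?(ltW r_gt0)//=.
      have : `|u - w| ^+ 2 < r ^+ 2 - (y - x) ^+ 2.
        rewrite -[ltRHS]sqr_sqrtr; last first.
          by rewrite ltW// -sqrtr_gt0 (le_lt_trans t0).
        by rewrite ltr_pXn2r// nnegrE// sqrtr_ge0.
      by rewrite real_normK ?num_real//; lra.
have layers_le : (mu2 (layers a k r) + (r ^+ 2 * (pi / 2))%:E <=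
    mu2 (layers c (k + 2) r))%E.
  have pi0 : 0 < pi / 2 :> R by rewrite divr_gt0// pi_gt0.
  have ms : measurable_fun setT s.
    by apply: continuous_measurable_fun; exact: continuous_semicircle.
  have -> : (r ^+ 2 * (pi / 2))%:E = (\int[mu]_(t in `[0%R, r]) (2 * s t)%:E)%E.
    under eq_integral do rewrite EFinM.
    rewrite ge0_integralZl//=; last 2 first.
    - by apply: measurable_funTS; exact/measurable_EFinP.
    - by move=> t _; rewrite lee_fin sqrtr_ge0.
    have := @integral_semicircle R 0 r 0 (pi / 2) r_gt0 pi0.
    rewrite sin0 sin_pihalf cos_pihalf mulr0 mulr1 !add0r => ->.
    - by rewrite -EFinM; congr EFin; field.
    - by rewrite in_itv/= oppr_le0 (ltW pi0).
    - by rewrite in_itv/= lexx andbT; lra.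
  have mS (f : mR -> \bar R) (l : R) : measurable_fun setT f ->
      measurable_fun setT (mu \o xsection (layers f l r)).
    by move=> mf; apply: measurable_fun_xsection; exact: measurable_layers.
  have s2_ge0 t : (0 <= ((fun t => (2 * s t)%:E) \_ `[0%R, r]) t)%E.
    by rewrite patchE; case: ifPn => // _; rewrite lee_fin mulr_ge0// sqrtr_ge0.
  have ms2 : measurable_fun setT ((fun t => (2 * s t)%:E) \_ `[0%R, r]).
    apply/(measurable_restrictT _ _).1; first exact: measurable_itv.
    by apply: measurable_funTS; apply/measurable_EFinP; exact: measurable_funM.
  rewrite [X in (_ + X)%E]integral_mkcond -ge0_integralD//; last exact: mS.
  apply: ge0_le_integral => //=.
  - by move=> t _; rewrite adde_ge0.
  - by apply: emeasurable_funD => //; exact: mS.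
  - exact: mS.
  move=> t _; rewrite patchE mem_setE in_itv/=; case: ifPn => [tr|ntr].
    exact: slice.
  rewrite adde0 (_ : xsection _ _ = set0) ?measure0 ?measure_ge0//.
  apply/seteqP; split=> // x; rewrite /xsection/= inE /layers/= => -[tr].
  by rewrite tr in ntr.
have lowerE := plane_measure_layers_ge ma k0 a0.
have upperN := le_trans layers_le (plane_measure_layers_le r mc k20 c0).
have {lowerE}lowerE : ((k^-1 * (pi * r0 ^+ 2))%:E <= mu2 (layers a k r))%E.
  by rewrite EFinM -muE mu2E; apply: lowerE => x; rewrite kr.
have {lowerE upperN} : ((k^-1 * (pi * r0 ^+ 2) + r ^+ 2 * (pi / 2))%:E <=
    (k + 2)^-1%:E * mu2 N)%E.
  by apply: le_trans upperN; rewrite EFinD leeD2r.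
have : (0 <= mu2 N)%E by exact: measure_ge0.
case: (mu2 N) => [n| |]// n0; last by rewrite leey.
rewrite -EFinM !lee_fin ler_pdivlMl// => Nle; apply: le_trans Nle.
(* The excess over [pi (r0 + r)^2] is a perfect square, vanishing when [alpha = 2 r0], as for a
   disk. *)
rewrite -subr_ge0 (_ : _ - _ = pi / (2 * k) * (k * r - 2 * r0) ^+ 2); last first.
  by field; rewrite gt_eqF.
by apply: mulr_ge0; rewrite ?sqr_ge0// divr_ge0 ?pi_ge0// mulr_ge0// ltW.
Qed.

End BrunnMinkowski.

(** * Disks crossed by a curve *)

Section Crossings.
Context {R : realType}.
Local Notation mu := (@lebesgue_measure R).
Local Notation mu2 := (mu \x mu)%E.
Local Notation mR := (measurableTypeR R).

(** Since distance is symmetric, these are the centers of the disks of radius [r] that contain one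
    of the vertices [c 0], ..., [c n] and miss another. *)
Definition polygon_crossings (c : nat -> R * R) (n : nat) (r : R) : set (mR * mR) :=
  (\bigcup_(i in `I_n.+1) disk (c i) r) `&` (\bigcup_(i in `I_n.+1) ~` disk (c i) r).

Lemma measurable_polygon_crossings (c : nat -> R * R) (n : nat) (r : R) :
  measurable (polygon_crossings c n r).
Proof.
apply: measurableI; apply: bigcup_measurable => i _; first exact: measurable_disk.
by apply: measurableC; exact: measurable_disk.
Qed.

(* Going once around, a point that some disk contains and another one misses
   must be dropped between two consecutive disks. *)
Lemma plane_measure_polygon_crossings (c : nat -> R * R) (n : nat) (r : R) :
  0 <= r -> c n = c 0%N ->
  (mu2 (polygon_crossings c n r) <=
   (2 * r * \sum_(i < n) enorm (c i.+1 - c i))%:E)%E.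
Proof.
move=> r0 c0n.
pose drop i : set (mR * mR) := disk (c i) r `\` disk (c i.+1) r.
have mdrop i : measurable (drop i) by apply: measurableD; exact: measurable_disk.
apply: (@le_trans _ _ (\sum_(i < n) mu2 (drop i))%E); last first.
  rewrite mulr_sumr -sumEFin; apply: lee_sum => i _; exact: plane_measure_diskD.
apply: content_subadditive => //; first exact: measurable_polygon_crossings.
move=> p [[i /= i_n pi] [j /= j_n pj]]; rewrite -bigcup_mkord.
have [//|no_drop] := pselect ((\bigcup_(i in `I_n) drop i) p).
have stay k l : (k <= l <= n)%N -> disk (c k) r p -> disk (c l) r p.
  move=> /andP[kl ln] pk; elim: l kl ln => [|l IH].
    by rewrite leqn0 => /eqP <-.
  rewrite leq_eqVlt => /predU1P[<-//|]; rewrite ltnS => kl ln.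
  have pl := IH kl (ltnW ln).
  by have [//|pl1] := pselect (disk (c l.+1) r p); case: no_drop; exists l.
(* From [i] the point stays inside up to [n], where the polygon closes at [c 0], and then from [0]
   up to [j]. *)
exfalso; apply: pj; apply: (stay 0%N) => //; rewrite -c0n.
by apply: (stay i) => //; rewrite -ltnS i_n leqnn.
Qed.

(** * Disks crossed by a closed curve of length at most [L] *)

Variables (a b L r : R) (g : R -> R * R) (ell : R -> R).
Hypotheses (ab : a < b) (r0 : 0 < r).
Hypothesis (g_cont : forall t e : R, a <= t <= b -> 0 < e ->
  exists2 d : R, 0 < d &
    forall s : R, a <= s <= b -> `|t - s| < d -> enorm (g s - g t) < e).
Hypothesis (g_closed : g a = g b).
Hypothesis (g_len : forall s t, a <= s -> s <= t -> t <= b ->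
  enorm (g t - g s) <= ell t - ell s).
Hypothesis (ellL : ell b - ell a <= L).

(** Both inequalities are strict, so that a crossing persists when the two points of the curve are
    replaced by nearby vertices. *)
Definition curve_crossings : set (mR * mR) :=
  [set p | (exists2 t, a <= t <= b & enorm (p - g t) < r) /\
           (exists2 t, a <= t <= b & r < enorm (p - g t))].

(** The crossing sets [F m] of the inscribed polygons with dyadic knots increase with [m], all
    satisfy the bound, and cover [X]; the measure is continuous along increasing unions. *)
Lemma plane_measure_curve_crossings (X : set (mR * mR)) :
  measurable X -> X `<=` curve_crossings -> (mu2 X <= (2 * r * L)%:E)%E.
Proof.
move=> mX XC.
pose knots (m i : nat) := a + (b - a) * (i%:R / 2 ^+ m).
have two0 m : 0 < 2 ^+ m :> R by rewrite exprn_gt0.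
have knots_itv m i : (i <= 2 ^ m)%N -> a <= knots m i <= b.
  move=> im; have i1 : 0 <= (i%:R / 2 ^+ m : R) <= 1.
    rewrite divr_ge0 ?(ltW (two0 m))//=.
    by rewrite ler_pdivrMr// mul1r -natrX ler_nat.
  by move: i1 ab; rewrite /knots; move: (_ / _) => z /andP[? ?] ?; apply/andP; split; nra.
have knots_le m i : knots m i <= knots m i.+1.
  rewrite lerD2l ler_pM2l ?subr_gt0// ler_pM2r ?invr_gt0// ler_nat.
  exact: leqnSn.
pose c m i := g (knots m i).
pose F m := polygon_crossings (c m) (2 ^ m) r.
have FL m : (mu2 (F m) <= (2 * r * L)%:E)%E.
  apply: le_trans (plane_measure_polygon_crossings (ltW r0) _) _.
    rewrite /c /knots natrX divff ?gt_eqF// mulr1 subrKC.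
    by rewrite mul0r mulr0 addr0 g_closed.
  rewrite lee_fin ler_pM2l ?mulr_gt0//; apply: le_trans ellL.
  apply: (@le_trans _ _ (\sum_(0 <= i < 2 ^ m) (ell (knots m i.+1) - ell (knots m i)))).
    rewrite big_mkord; apply: ler_sum => i _; apply: g_len => //.
      by case/andP: (knots_itv m i (ltnW (ltn_ord i))).
    by case/andP: (knots_itv m i.+1 (ltn_ord i)).
  rewrite telescope_sumr// /knots natrX divff ?gt_eqF// mulr1 subrKC.
  by rewrite mul0r mulr0 addr0.
have mF m : measurable (F m) by exact: measurable_polygon_crossings.
have mUF : measurable (\bigcup_m F m) by exact: bigcupT_measurable.
(* Knot [i] of level [m] is knot [2 i] of level [m + 1], so vertices are only added. *)
have ndF : nondecreasing_seq F.
  apply/nondecreasing_seqP => m; apply/subsetPset.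
  have dbl i : (i < (2 ^ m).+1)%N -> (i.*2 < (2 ^ m.+1).+1)%N /\ c m.+1 i.*2 = c m i.
    rewrite !ltnS expnS mul2n leq_double => im; split=> //.
    by rewrite /c /knots -muln2 natrM exprS; congr (g (a + _ * _)); field; rewrite ?gt_eqF.
  move=> p [[i /= /dbl[im <-] pi] [j /= /dbl[jm <-] pj]]; split.
    by exists i.*2.
  by exists j.*2.
(* The witness is the knot just below [t], found by truncation; the mesh [(b - a) / 2^m] is below
   [d] because [m0 + 1 <= 2^m]. *)
have approx t d : a <= t <= b -> 0 < d ->
    exists m0, forall m, (m0 <= m)%N ->
      exists2 i, (i < (2 ^ m).+1)%N & `|t - knots m i| < d.
  move=> tab d0; have ba0 : 0 < b - a by rewrite subr_gt0.
  have [m0 m0d] := ltr_add_invr (divr_gt0 d0 ba0); rewrite add0r in m0d.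
  exists m0 => m m0m; pose u : R := (t - a) / (b - a).
  have u01 : 0 <= u <= 1.
    by rewrite divr_ge0 ?(ltW ba0) ?ler_pdivrMr ?mul1r//; move: tab; lra.
  have /truncn_itv/andP[iu ui] : 0 <= u * 2 ^+ m.
    by rewrite mulr_ge0 ?(ltW (two0 m))//; case/andP: u01.
  exists (Num.truncn (u * 2 ^+ m)).
    rewrite ltnS -(ler_nat R) natrX (le_trans iu)// ger_pMl//; first by case/andP: u01.
  have tu : t = a + (b - a) * u by rewrite /u mulrC divfK ?gt_eqF// subrKC.
  rewrite [X in `|X - _|]tu /knots opprD addrACA subrr add0r -mulrBr normrM gtr0_norm//.
  rewrite mulrC -ltr_pdivlMr//; apply: lt_trans m0d.
  set i := Num.truncn _ in iu ui *.
  have ui0 : 0 <= u - i%:R / 2 ^+ m by rewrite subr_ge0 ler_pdivrMr.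
  rewrite ger0_norm// ltrBlDr; apply: (@lt_le_trans _ _ (i.+1%:R / 2 ^+ m)).
    by rewrite ltr_pdivlMr.
  rewrite -addn1 natrD mulrDl addrC lerD2r mul1r lef_pV2 ?posrE ?ltr0n//.
  by rewrite -natrX ler_nat (leq_ltn_trans m0m)// ltn_expl.
have XF : X `<=` \bigcup_m F m.
  move=> p /XC[[t tab pt] [s sab ps]].
  have [d d0 Hd] := g_cont tab (ltac:(by rewrite subr_gt0) : 0 < r - enorm (p - g t)).
  have [e e0 He] := g_cont sab (ltac:(by rewrite subr_gt0) : 0 < enorm (p - g s) - r).
  have [m1 H1] := approx _ _ tab d0; have [m2 H2] := approx _ _ sab e0.
  have [i im ti] := H1 _ (leq_maxl m1 m2); have [j jm sj] := H2 _ (leq_maxr m1 m2).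
  exists (maxn m1 m2) => //; split.
    exists i => //; rewrite /disk/=; have := Hd _ (knots_itv _ _ im) ti.
    have := ler_enorm_distD (g t) p (c (maxn m1 m2) i).
    by rewrite [enorm (g t - _)]enorm_distC -/(c _ i); lra.
  exists j => //; rewrite /disk/=; apply/negP; rewrite -leNgt.
  have := He _ (knots_itv _ _ jm) sj.
  have := ler_enorm_distD (c (maxn m1 m2) j) p (g s).
  by rewrite -/(c _ j); lra.
apply: (@le_trans _ _ (mu2 (\bigcup_m F m))).
  by apply: le_measure; rewrite ?inE.
have cvgF := @nondecreasing_cvg_mu _ _ _ mu2 F mF mUF ndF.
rewrite -(cvg_lim _ cvgF)//; apply: lime_le; first by apply/cvg_ex; eexists; exact: cvgF.
by apply: nearW => m; exact: FL.
Qed.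

End Crossings.

(** * Arc length *)

Section ArcLength.
Context {R : realType}.
Local Notation mu := (@lebesgue_measure R).
Implicit Types (f : R -> R) (g : R -> R * R) (a b s t : R).

Lemma within_dnbhs_interior a b t : a < t < b -> within `[a, b] t^' = t^'.
Proof.
move=> /andP[a_t t_b]; apply/funext => U; apply/propext; split; last first.
  by rewrite /within/=; apply: filterS.
have : \forall s \near t^', s \in `[a, b].
  have : \forall s \near t, s \in `[a, b].
    have : t \in `]a, b[ by rewrite in_itv/= a_t.
    by move=> /near_in_itvoo; apply: filterS => s; exact: subset_itv_oo_cc.
  by apply: filterS.
by move=> sab; rewrite /within/=; apply: filterS2 sab => s sab; exact.
Qed.

Lemma cvg_shift_dnbhs t : h + t @[h --> (0 : R)^'] --> t^'.
Proof.
move=> U; rewrite /dnbhs/= => tU.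
have : h + t @[h --> (0 : R)] --> t.
  by rewrite -[X in _ --> X]add0r; apply: cvgD; [exact: cvg_id|exact: cvg_cst].
move=> /(_ _ tU) tU'; have {}tU' : \forall h \near (0 : R), h + t != t -> U (h + t) by [].
suff : \forall h \near (0 : R), h != 0 -> U (h + t) by [].
apply: filterS tU' => h hU h0; apply: hU.
by rewrite -subr_eq0 addrK.
Qed.

(** Inside the interval the restriction of the limit to [[a, b]] has no effect, so the library's
    derivative is recovered and the fundamental theorem of calculus applies. *)
Lemma derivative_on_interior f a b t : derivable_on a b f -> a < t < b ->
  is_derive t 1 f (derivative_on a b f t).
Proof.
move=> df tab; have tab' : t \in `[a, b] by rewrite in_itv/= !ltW; case/andP: tab.
have := df t tab'; rewrite /derivative_on within_dnbhs_interior// => /cvg_ex[l fl].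
rewrite (cvg_lim _ fl)//.
suff fl' : h^-1 *: ((f \o shift t) (h *: 1) - f t) @[h --> 0^'] --> l.
  by split; [apply: cvgP fl'|exact: cvg_lim fl'].
have fl' := cvg_comp _ _ (@cvg_shift_dnbhs t) fl.
apply: cvg_trans fl'.
apply: near_eq_cvg; apply: nearW => h /=.
by rewrite /diff_quotient addrK /GRing.scale/= mulr1 mulrC.
Qed.

Lemma segment_subset a b s t : a <= s -> t <= b -> `[s, t] `<=` `[a, b].
Proof.
move=> as_ tb x; rewrite /= !in_itv/= => /andP[sx xt].
by rewrite (le_trans as_) ?(le_trans xt).
Qed.

Lemma integral_derivative_on f a b s t : {within `[a, b], continuous f} ->
  continuously_differentiable_on a b f -> a <= s -> s < t -> t <= b ->
  (\int[mu]_(x in `[s, t]) (derivative_on a b f x)%:E = (f t - f s)%:E)%E.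
Proof.
move=> cf [df cdf] as_ st tb; rewrite EFinB.
have sub := segment_subset as_ tb.
have stab x : x \in `]s, t[ -> a < x < b.
  by rewrite in_itv/= => /andP[sx xt]; rewrite (le_lt_trans as_) ?(lt_le_trans xt).
apply: continuous_FTC2 => //.
- exact: continuous_subspaceW cdf.
- have /(continuous_within_itvP _ st)[_ cs ct] : {within `[s, t], continuous f}.
    exact: continuous_subspaceW cf.
  split => // x /stab xab; apply: (@ex_derive _ _ _ _ _ _ (derivative_on a b f x)).
  exact: derivative_on_interior.
- move=> x /stab xab; rewrite derive1E; apply: derive_val.
  exact: derivative_on_interior.
Qed.

Lemma continuous_speed_on a b g : nicely_rectifiable a b g ->
  {within `[a, b], continuous (speed_on a b g)}.
Proof.
move=> [[_ cx] [_ cy] _]; apply/subspace_continuousP => t tab.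
move: cx cy => /subspace_continuousP/(_ t tab) cx /subspace_continuousP/(_ t tab) cy.
pose q t := derivative_on a b (xcoord g) t ^+ 2 + derivative_on a b (ycoord g) t ^+ 2.
apply: (@cvg_comp _ _ _ q Num.sqrt _ (nbhs (q t))); last exact: sqrt_continuous.
by apply: cvgD; [exact: (cvgM cx cx)|exact: (cvgM cy cy)].
Qed.

Lemma integrable_speed_on a b s t g : nicely_rectifiable a b g -> a <= s -> t <= b ->
  mu.-integrable `[s, t] (EFin \o speed_on a b g).
Proof.
move=> ng as_ tb; apply: continuous_compact_integrable; first exact: segment_compact.
apply: continuous_subspaceW (continuous_speed_on ng); exact: segment_subset.
Qed.

(** With [v = g t - g s], one has [|v|^2 = v . v], the integral of [v . g'], which is at most [|v|]
    times the integral of the speed by Cauchy-Schwarz. *)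
Lemma speed_on_chord a b s t g : {within `[a, b], continuous g} ->
  nicely_rectifiable a b g -> a <= s -> s <= t -> t <= b ->
  enorm (g t - g s) <= \int[mu]_(x in `[s, t]) speed_on a b g x.
Proof.
move=> cg ng as_; rewrite le_eqVlt => /predU1P[->|st] tb.
  by rewrite subrr enorm0 Rintegral_ge0// => x _; exact: sqrtr_ge0.
have [N0|N0] := eqVneq (enorm (g t - g s)) 0.
  by rewrite N0 Rintegral_ge0// => x _; exact: sqrtr_ge0.
have N_gt0 : 0 < enorm (g t - g s) by rewrite lt_neqAle eq_sym N0 enorm_ge0.
have [dx dy _] := ng.
have cx : {within `[a, b], continuous (xcoord g)}.
  move=> x; apply: (@continuous_comp _ _ _ (g : subspace _ -> _) fst);
    by [exact: cg|exact: cvg_fst].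
have cy : {within `[a, b], continuous (ycoord g)}.
  move=> x; apply: (@continuous_comp _ _ _ (g : subspace _ -> _) snd);
    by [exact: cg|exact: cvg_snd].
have ix := integral_derivative_on cx dx as_ st tb.
have iy := integral_derivative_on cy dy as_ st tb.
have sub := segment_subset as_ tb.
have intx : mu.-integrable `[s, t] (EFin \o derivative_on a b (xcoord g)).
  apply: continuous_compact_integrable; first exact: segment_compact.
  by apply: continuous_subspaceW (dx.2).
have inty : mu.-integrable `[s, t] (EFin \o derivative_on a b (ycoord g)).
  apply: continuous_compact_integrable; first exact: segment_compact.
  by apply: continuous_subspaceW (dy.2).
set v := g t - g s in N0 N_gt0 *.
rewrite -(ler_pM2l N_gt0) -expr2 sqr_enorm -RintegralZl//; last exact: integrable_speed_on.
have -> : v.1 ^+ 2 + v.2 ^+ 2 = \int[mu]_(x in `[s, t])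
   (v.1 * derivative_on a b (xcoord g) x + v.2 * derivative_on a b (ycoord g) x).
  rewrite RintegralD//; [|exact: (integrableZl _ v.1 intx)|
    exact: (integrableZl _ v.2 inty)].
  by rewrite !RintegralZl// /Rintegral ix iy /= !expr2.
apply: le_Rintegral => //.
- by apply: (integrableD _ (integrableZl _ v.1 intx) (integrableZl _ v.2 inty)).
- exact: (integrableZl _ _ (integrable_speed_on ng as_ tb)).
- move=> x _; exact: (ler_dot_enorm v (_, _)).
Qed.

Lemma Rintegral_speed_onB a b s t g : nicely_rectifiable a b g ->
  a <= s -> s <= t -> t <= b ->
  \int[mu]_(x in `[a, t]) speed_on a b g x - \int[mu]_(x in `[a, s]) speed_on a b g x =
  \int[mu]_(x in `[s, t]) speed_on a b g x.
Proof.
move=> ng as_ st tb; rewrite Rintegral_itvB//.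
  apply: Rintegral_itv_obnd_cbnd.
  apply: (integrableS _ _ _ (integrable_speed_on ng as_ tb)) => //.
  by move=> x; rewrite /= !in_itv/= => /andP[/ltW -> ->].
exact: integrable_speed_on.
Qed.

Lemma partition_le a b n p i : is_partition a b n p -> (i <= n)%N -> a <= p i <= b.
Proof.
move=> [p0 pn ltp] i_n.
have lep k l : (k <= l <= n)%N -> p k <= p l.
  move=> /andP[kl]; elim: l kl => [|l IH]; first by rewrite leqn0 => /eqP ->.
  rewrite leq_eqVlt => /predU1P[->//|]; rewrite ltnS => kl ln.
  by rewrite (le_trans (IH kl (ltnW ln)))// ltW// ltp.
by rewrite -p0 -pn !lep// ?i_n ?leqnn.
Qed.

(** The primitives of the speeds of the pieces are glued by induction on the number of pieces. Chord
    bounds and total length are all that the crossing estimate asks of [ell]. *)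
Lemma arc_length_function a b n p g : piecewise_nice a b n p g ->
  exists ell : R -> R,
    (forall s t, a <= s -> s <= t -> t <= b -> enorm (g t - g s) <= ell t - ell s) /\
    ell b - ell a =
      \sum_(i < n) \int[mu]_(t in `[p i, p i.+1]) speed_on (p i) (p i.+1) g t.
Proof.
elim: n b => [|n IH] b [Hp cg ng].
  (* Without pieces [a = b], so [s] and [t] coincide. *)
  case: Hp => p0 pn _; exists (fun=> 0); rewrite big_ord0 subrr; split => // s t as_ st tb.
  have -> : s = t by apply/eqP; rewrite eq_le st (le_trans tb)// -pn p0.
  by rewrite /= !subrr enorm0.
have /andP[ac cb] := partition_le Hp (leqnSn n).
case: (Hp) => p0 pn ltp.
have [|ell1 [chord1 sum1]] := IH (p n).
  split; [|exact: continuous_subspaceW (segment_subset (lexx a) cb) cg|].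
    by split => // i /ltnW; exact: ltp.
  by move=> i /ltnW; exact: ng.
have ng2 := ng n (ltnSn n).
have cg2 : {within `[p n, p n.+1], continuous g}.
  by rewrite pn; apply: continuous_subspaceW (segment_subset ac (lexx b)) cg.
pose ell2 t := \int[mu]_(x in `[p n, t]) speed_on (p n) (p n.+1) g x.
have chord2 s t : p n <= s -> s <= t -> t <= b -> enorm (g t - g s) <= ell2 t - ell2 s.
  rewrite -pn => cs st tb; rewrite /ell2 Rintegral_speed_onB//.
  exact: speed_on_chord.
have ell2c : ell2 (p n) = 0 by rewrite /ell2 set_itv1 Rintegral_set1.
(* [ell2] vanishes at [p n], so the two formulas agree there; a chord across [p n] is split at
   [g (p n)]. *)
exists (fun t => if t <= p n then ell1 t else ell1 (p n) + ell2 t); split; last first.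
  rewrite big_ord_recr/= -sum1 ac -pn leNgt ltp//= addrAC; congr (_ + _).
move=> s t as_ st tb; case: (leP t (p n)) => [tc|ct].
  by rewrite (le_trans st tc); exact: chord1.
case: (leP s (p n)) => [sc|cs].
  apply: (le_trans (ler_enorm_distD (g (p n)) _ _)).
  have := chord1 _ _ as_ sc (lexx _); have := chord2 _ _ (lexx _) (ltW ct) tb.
  by rewrite ell2c; lra.
by have := chord2 _ _ (ltW cs) st tb; lra.
Qed.

End ArcLength.

(** * Filling a closed set *)

Section FilledSet.
Context {R : realType}.
Implicit Types (K : set (R * R)) (p q c : R * R) (r : R).
Local Notation mR := (measurableTypeR R).

(** This is [region] with an arbitrary plane set in place of the curve. *)
Definition filled K : set (R * R) :=
  K `|` [set p | (~` K) p /\ bounded_set (connected_component (~` K) p)].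

Definition segment p q : set (R * R) :=
  [set (p.1 + t * (q.1 - p.1), p.2 + t * (q.2 - p.2)) | t in `[0, 1]].

Lemma continuous_affine_curve (x y u v : R) :
  continuous (fun t : R => (x + t * u, y + t * v)).
Proof.
have affine (z w : R) : continuous (fun t : R => z + t * w).
  by move=> t; apply: cvgD; [exact: cvg_cst|apply: cvgM; [exact: cvg_id|exact: cvg_cst]].
move=> t; exact: (cvg_pair (affine x u t) (affine y v t)).
Qed.

Lemma segment_component K p q : segment p q `&` K = set0 ->
  connected_component (~` K) p = connected_component (~` K) q.
Proof.
move=> pqK; apply: same_connected_component.
apply: (@connected_component_max _ (~` K) (segment p q)).
- by exists 0; rewrite /= ?in_itv/= ?lexx ?ler01// !mul0r !addr0; case: (p).
- by rewrite -disjoints_subset.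
- apply: connected_continuous_connected; first exact: segment_connected.
  by apply: continuous_subspaceT; exact: continuous_affine_curve.
- exists 1; rewrite /= ?in_itv/= ?lexx ?ler01// !mul1r ![_ + (_ - _)]addrC !subrK.
  by case: (q).
Qed.

Lemma segment_disk c r p q : disk c r p -> disk c r q -> segment p q `<=` disk c r.
Proof.
by move=> pc qc _ [t /= t01 <-]; apply: disk_convex => //; rewrite in_itv in t01.
Qed.

Lemma disk_center c r : 0 < r -> disk c r c.
Proof. by move=> r0; rewrite /disk/= subrr enorm0. Qed.

(** Segments from [p] stay in the disk and avoid [K], so the whole disk lies in the component of
    [p], which is bounded. *)
Lemma filled_disk K c r p : disk c r `&` K = set0 -> disk c r p -> filled K p ->
  disk c r `<=` filled K.
Proof.
move=> cK cp Kp q cq; right; case: Kp => [Kp|[_ Bp]].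
  by exfalso; have : (disk c r `&` K) p by []; rewrite cK.
split=> [Kq|]; first by have : (disk c r `&` K) q by []; rewrite cK.
rewrite -(@segment_component _ p)//; apply/seteqP; split=> // z [pqz Kz].
by rewrite -cK; split=> //; exact: segment_disk pqz.
Qed.

Lemma ler_coord_enorm p r : enorm p <= r -> `|p.1| <= r /\ `|p.2| <= r.
Proof.
move=> pr; split; rewrite -sqrtr_sqr; apply: le_trans pr; apply: ler_wsqrtr.
  by rewrite lerDl sqr_ge0.
by rewrite lerDr sqr_ge0.
Qed.

(** The balls of the product topology are squares; a Euclidean disk of the same radius fits
    inside. *)
Lemma disk_avoiding K p : closed K -> ~ K p ->
  exists2 r : R, 0 < r & disk p r `&` K = set0.
Proof.
move=> cK Kp; have /nbhs_ballP[e /= e0 pe] : nbhs p (~` K).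
  by apply: open_nbhs_nbhs; split=> //; exact: closed_openC.
exists e => //; apply/seteqP; split=> // q [qp Kq].
suff /pe : ball p e q by [].
have [le1 le2] := ler_coord_enorm (lexx (enorm (q - p))).
by split; rewrite /ball/= distrC; [exact: le_lt_trans le1 qp|exact: le_lt_trans le2 qp].
Qed.

Lemma open_disk_nbhs (A : set (R * R)) :
  (forall p, A p -> exists2 r : R, 0 < r & disk p r `<=` A) -> open A.
Proof.
move=> HA; rewrite openE => p /HA[r r0 prA]; rewrite /interior.
apply: (filterS prA); apply: open_nbhs_nbhs; split; first exact: open_disk.
exact: disk_center.
Qed.

(** The part of the filling outside [K] is open: around each of its points, a disk avoiding [K]
    belongs to it. *)
Lemma measurable_filled K : closed K -> measurable (filled K : set (mR * mR)).
Proof.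
move=> cK; apply: measurableU; first exact: closed_measurable2.
apply: open_measurable2; apply: open_disk_nbhs => p [Kp Bp].
have [r r0 rK] := disk_avoiding cK Kp; exists r => // q pq.
have [Kq|//] : filled K q.
  by apply: (filled_disk rK (disk_center _ r0)) => //; right.
by exfalso; have : (disk p r `&` K) q by []; rewrite rK.
Qed.

(** Relates lengths to the sup norm, in which [bounded_set] is expressed. *)
Lemma ler_enorm_norm p : enorm p <= 2 * `|p|.
Proof.
rewrite ler_enorm_sqr ?mulr_ge0// exprMn.
have le1 : `|p.1| <= `|p| by rewrite prod_normE le_max lexx.
have le2 : `|p.2| <= `|p| by rewrite prod_normE le_max lexx orbT.
have sq (x : R) : `|x| <= `|p| -> x ^+ 2 <= `|p| ^+ 2.
  by move=> xp; rewrite -real_normK ?num_real// ler_pXn2r// nnegrE.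
by have := sq _ le1; have := sq _ le2; have := sqr_ge0 `|p|; lra.
Qed.

(* A point outside the disk escapes to infinity along the ray issued from the
   center. *)
Lemma filled_sub_closed_disk K c r : 0 <= r -> K `<=` closed_disk c r ->
  filled K `<=` closed_disk c r.
Proof.
move=> r0 Kc p [/Kc//|[Kp [M [_ BM]]]]; rewrite /closed_disk/= leNgt; apply/negP => rp.
pose N := enorm (p - c); have N0 : 0 < N by exact: le_lt_trans rp.
pose ray (s : R) : R * R := (p.1 + s * (p.1 - c.1), p.2 + s * (p.2 - c.2)).
have ray_c s : 0 <= s -> enorm (ray s - c) = (1 + s) * N.
  move=> s0; rewrite -(ger0_norm (_ : 0 <= 1 + s)) ?addr_ge0// -enormZ.
  by congr enorm; congr pair => /=; ring.
have rayK s : 0 <= s -> (~` K) (ray s).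
  move=> s0 /Kc; rewrite /closed_disk/= ray_c// leNgt => /negP; apply.
  by apply: (lt_le_trans rp); rewrite -/N ler_peMl ?(ltW N0)// lerDl.
have ray_comp s : 0 <= s -> connected_component (~` K) p (ray s).
  move=> s0; exists (ray @` `[0, s]); last by exists s => //=; rewrite in_itv/= s0 lexx.
  split.
  - by exists 0; rewrite /= ?in_itv/= ?lexx// /ray !mul0r !addr0; case: (p).
  - by move=> _ [u /= + <-]; rewrite in_itv/= => /andP[u0 _]; exact: rayK.
  - apply: connected_continuous_connected; first exact: segment_connected.
    by apply: continuous_subspaceT; exact: continuous_affine_curve.
(* Then [|ray s - c| = N + 2 |M + 1| + |c|], which exceeds what the bound [M + 1] on the component
   allows. *)
pose s := (2 * `|M + 1| + enorm c) / N.
have s0 : 0 <= s by rewrite divr_ge0 ?(ltW N0)// addr_ge0 ?enorm_ge0 ?mulr_ge0.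
have := BM (M + 1) (ltr_pwDr ltr01 (lexx _)) _ (ray_comp _ s0) => /= rayM.
have := ler_enormD (ray s) (- c); rewrite enormN ray_c//.
have sN : s * N = 2 * `|M + 1| + enorm c by rewrite /s divfK// gt_eqF.
have := ler_enorm_norm (ray s); have := ler_norm (M + 1).
by move: rayM sN; move: (`|ray s|) (`|M + 1|) => x y *; nra.
Qed.

End FilledSet.

(** * The isoperimetric inequality *)

Section Isoperimetry.
Context {R : realType}.
Variable U : plane_shape R.
Local Notation mu := (@lebesgue_measure R).
Local Notation mu2 := (mu \x mu)%E.
Local Notation mR := (measurableTypeR R).
Local Notation a := (left_end U).
Local Notation b := (right_end U).
Local Notation g := (param U).
Local Notation K := (curve U).
Local Notation L := (perimeter U).
Implicit Types (p q c : R * R) (r : R).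

Let ab : a < b. Proof. exact: plane_shape_lt. Qed.

Let g_within : {within `[a, b], continuous g}.
Proof. by have [_ gc _] := plane_shape_nice U. Qed.

Lemma curve_cont (t e : R) : a <= t <= b -> 0 < e ->
  exists2 d : R, 0 < d &
    forall s : R, a <= s <= b -> `|t - s| < d -> enorm (g s - g t) < e.
Proof.
move=> tab e0; have tab' : `[a, b]%classic t by rewrite /= in_itv.
move/subspace_continuousP : (g_within) => /(_ t tab') gt.
have : nbhs (g t) (disk (g t) e).
  by apply: open_nbhs_nbhs; split; [exact: open_disk|exact: disk_center].
move=> /gt; rewrite /within/= => /nbhs_ballP[d /= d0 dt].
by exists d => // s sab ts; apply: (dt s ts); rewrite in_itv.
Qed.

Lemma closed_curve : closed K.
Proof.
apply: compact_closed; first exact: norm_hausdorff.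
by apply: continuous_compact => //; exact: segment_compact.
Qed.

Lemma curve_length : exists ell : R -> R,
  (forall s t, a <= s -> s <= t -> t <= b -> enorm (g t - g s) <= ell t - ell s) /\
  ell b - ell a = L.
Proof. by have [ell [? ?]] := arc_length_function (plane_shape_nice U); exists ell. Qed.

(** A crude bound, which makes the region bounded. *)
Lemma curve_sub_closed_disk : K `<=` closed_disk (g a) L.
Proof.
have [ell [chord <-]] := curve_length.
move=> _ [t + <-]; rewrite /= in_itv/= => /andP[at_ tb].
apply: (le_trans (chord _ _ (lexx _) at_ tb)); rewrite lerD2r -subr_ge0.
exact: le_trans (enorm_ge0 _) (chord _ _ at_ tb (lexx _)).
Qed.

(** By injectivity the midpoint of the parameter interval is not sent to [g a], and the length
    bounds the sum of the two chords there. *)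
Lemma perimeter_gt0 : 0 < L.
Proof.
have [ell [chord <-]] := curve_length.
pose m := (a + b) / 2; have amb : a < m < b by rewrite !midf_lt ?ab.
have /andP[am mb] := amb.
have [_ ginj] := plane_shape_simple_closed U.
have : g m != g a.
  apply/eqP => gma; have ma : m = a.
    by apply: ginj => //; rewrite in_itv/= ?lexx ?ab ?mb ?(ltW am).
  by rewrite ma ltxx in am.
rewrite -subr_eq0 -enorm_eq0 => N0.
have := chord a m (lexx _) (ltW am) (ltW mb); have := chord m b (ltW am) (ltW mb) (lexx _).
have := enorm_ge0 (g b - g m).
have : 0 < enorm (g m - g a) by rewrite lt_neqAle eq_sym N0 enorm_ge0.
lra.
Qed.

Lemma plane_measure_crossings (X : set (mR * mR)) r : 0 < r -> measurable X ->
  (forall p, X p -> (exists2 q, K q & enorm (p - q) < r) /\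
                    (exists2 q, K q & r < enorm (p - q))) ->
  (mu2 X <= (2 * r * L)%:E)%E.
Proof.
move=> r0 mX XK; have [ell [chord ellL]] := curve_length.
have [gab _] := plane_shape_simple_closed U.
apply: (plane_measure_curve_crossings ab r0 curve_cont gab chord) => //.
  by rewrite ellL.
move=> p /XK[[_ [t + <-] ?] [_ [u + <-] ?]]; rewrite /= !in_itv/= => tab uab.
by split; [exists t|exists u].
Qed.

Lemma regionE : region U = filled K. Proof. by []. Qed.

Lemma measurable_region : measurable (region U : set (mR * mR)).
Proof. by rewrite regionE; apply: measurable_filled; exact: closed_curve. Qed.

Lemma region_sub_closed_disk c r : 0 <= r -> K `<=` closed_disk c r ->
  region U `<=` closed_disk c r.
Proof. exact: filled_sub_closed_disk. Qed.

(** [area] is a real-valued integral; it represents the measure because a bounded region has finite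
    measure. *)
Lemma plane_measure_region : mu2 (region U) = (area U)%:E.
Proof.
rewrite /area Rintegral_cst ?mul1r; last exact: measurable_region.
have L0 := ltW perimeter_gt0.
rewrite fineK// ge0_fin_numE; last exact: measure_ge0.
apply: (@le_lt_trans _ _ (mu2 (closed_disk (g a) L))); last first.
  by rewrite (le_lt_trans (plane_measure_closed_disk_le _ L0))// ltry.
apply: le_measure; rewrite ?inE; [exact: measurable_region|exact: measurable_closed_disk|].
exact: region_sub_closed_disk L0 curve_sub_closed_disk.
Qed.

Lemma area_le_disk c r : 0 <= r -> K `<=` closed_disk c r -> area U <= pi * r ^+ 2.
Proof.
move=> r0 Kc; rewrite -lee_fin -plane_measure_region.
apply: le_trans (plane_measure_closed_disk_le c r0).
apply: le_measure; rewrite ?inE; [exact: measurable_region|exact: measurable_closed_disk|].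
exact: region_sub_closed_disk.
Qed.

(** * Comparison with the disk of the same area, of radius [r0] *)

Variable r0 : R.
Hypotheses (r0_gt0 : 0 < r0) (areaE : area U = pi * r0 ^+ 2).

(* Unless a disk of radius [r] fits in the region or covers the curve, every
   such disk that meets the region is crossed by the curve. *)
Lemma perimeter_ge_thickening r : 0 < r ->
  (forall c, ~ disk c r `<=` region U) -> (forall c, ~ K `<=` closed_disk c r) ->
  pi * (r0 + r) ^+ 2 <= 2 * r * L.
Proof.
move=> r_gt0 no_in no_out.
pose N : set (mR * mR) := \bigcup_(q in region U) disk q r.
have mN : measurable N.
  by apply: open_measurable2; apply: bigcup_open => q _; exact: open_disk.
have L0 := ltW perimeter_gt0.
have NK p : N p -> (exists2 q, K q & enorm (p - q) < r) /\
                   (exists2 q, K q & r < enorm (p - q)).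
  move=> [q Uq]; rewrite /disk/= enorm_distC => qp; split.
    apply: contrapT => pK; apply: (no_in p).
    apply: (@filled_disk _ K p r q) => //; apply/seteqP; split=> // z [pz Kz].
    by apply: pK; exists z => //; rewrite enorm_distC.
  apply: contrapT => pK; apply: (no_out p) => z Kz.
  rewrite /closed_disk/= enorm_distC leNgt; apply/negP => rz.
  by apply: pK; exists z.
rewrite -lee_fin; apply: le_trans (plane_measure_crossings r_gt0 mN NK).
pose M := L + `|(g a).1| + `|(g a).2|.
apply: (@plane_measure_thickening _ (region U) N M) => //.
- exact: measurable_region.
- move=> p /(region_sub_closed_disk L0 curve_sub_closed_disk).
  move=> /ler_coord_enorm[/= p1 p2]; rewrite /M.
  have := normr_ge0 (g a).1; have := normr_ge0 (g a).2.
  have := ler_normD (p.1 - (g a).1) (g a).1; have := ler_normD (p.2 - (g a).2) (g a).2.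
  by rewrite !subrK; lra.
- by move=> p Up z pz; exists p.
- by rewrite plane_measure_region areaE.
Qed.

(** Two antipodal points of the circle are [2 r0 > 2 r] apart, so [p] cannot be within [r] of
    both. *)
Lemma curve_far c r p : closed_disk c r0 `\` disk c r0 `<=` K -> r < r0 ->
  exists2 q, K q & r < enorm (p - q).
Proof.
move=> cK rr0; pose q1 := (c.1 + r0, c.2); pose q2 := (c.1 - r0, c.2).
have q1c : enorm (q1 - c) = r0.
  by rewrite /enorm/= subrr expr0n/= addr0 sqrtr_sqr addrAC subrr add0r gtr0_norm.
have q2c : enorm (q2 - c) = r0.
  by rewrite /enorm/= subrr expr0n/= addr0 sqrtr_sqr addrAC subrr add0r normrN gtr0_norm.
have q12 : enorm (q1 - q2) = 2 * r0.
  rewrite /enorm/= subrr expr0n/= addr0 sqrtr_sqr (_ : _ - _ = 2 * r0); last by ring.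
  by rewrite gtr0_norm// mulr_gt0.
have [pq1|pq1] := ltP r (enorm (p - q1)).
  by exists q1 => //; apply: cK; rewrite /disk/closed_disk/= q1c lexx ltxx.
exists q2; first by apply: cK; rewrite /disk/closed_disk/= q2c lexx ltxx.
have := ler_enorm_distD p q1 q2; rewrite q12 [enorm (q1 - p)]enorm_distC; lra.
Qed.

(** The points at distance less than [r] from the circle form an annulus. They and the points of
    [D], which avoids the annulus, are centers of disks crossed by the curve. The inner disk is
    moved to the right to avoid a subtraction of measures. *)
Lemma perimeter_ge_annulus c r (D : set (mR * mR)) :
  closed_disk c r0 `\` disk c r0 `<=` K -> 0 < r -> r < r0 -> measurable D ->
  (forall p, D p -> exists2 q, K q & enorm (p - q) < r) ->
  (forall p, D p -> ~ (r0 - r < enorm (p - c) < r0 + r)) ->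
  ((pi * (r0 + r) ^+ 2)%:E + mu2 D <= (2 * r * L + pi * (r0 - r) ^+ 2)%:E)%E.
Proof.
move=> cK r_gt0 rr0 mD DK Dc.
pose A : set (mR * mR) := disk c (r0 + r) `\` closed_disk c (r0 - r).
have mA : measurable A.
  by apply: measurableD; [exact: measurable_disk|exact: measurable_closed_disk].
have Ac p : A p -> r0 - r < enorm (p - c) < r0 + r.
  by move=> [pc /negP]; rewrite /closed_disk/= -ltNge => ->.
have AD0 : [disjoint A & D].
  by apply/disj_setPS => p [/Ac pA /Dc].
have AK p : A p -> exists2 q, K q & enorm (p - q) < r.
  move=> /Ac/andP[pc1 pc2]; pose N := enorm (p - c).
  have N0 : 0 < N by apply: lt_trans pc1; rewrite subr_gt0.
  (* The radial projection of [p] to the circle, at distance [|N - r0| < r] from [p]. *)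
  pose q := (c.1 + r0 / N * (p - c).1, c.2 + r0 / N * (p - c).2).
  have qc : enorm (q - c) = r0.
    rewrite (_ : q - c = (r0 / N * (p - c).1, r0 / N * (p - c).2)).
      by rewrite enormZ gtr0_norm ?divr_gt0// -/N divfK// gt_eqF.
    by rewrite /q; congr pair => /=; ring.
  exists q; first by apply: cK; rewrite /disk/closed_disk/= qc lexx ltxx.
  rewrite (_ : p - q = ((1 - r0 / N) * (p - c).1, (1 - r0 / N) * (p - c).2)); last first.
    by rewrite /q; case: (p) => x y; congr pair => /=; ring.
  rewrite enormZ -/N -[X in _ * X](gtr0_norm N0) -normrM mulrBl mul1r divfK ?gt_eqF//.
  by rewrite ltr_norml; move: pc1 pc2; rewrite -/N; lra.
have AD_le : (mu2 (A `|` D) <= (2 * r * L)%:E)%E.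
  apply: plane_measure_crossings => //; first exact: measurableU.
  by move=> p pAD; split; [case: pAD => [/AK|/DK]|exact: (curve_far p cK)].
have cover : disk c (r0 + r) `<=` A `|` closed_disk c (r0 - r).
  by move=> p pc; have [?|?] := pselect (closed_disk c (r0 - r) p); [right|left].
have rr_ge0 : 0 <= r0 + r by rewrite addr_ge0// ltW.
rewrite -(plane_measure_disk c rr_ge0).
apply: (@le_trans _ _ (mu2 A + mu2 (closed_disk c (r0 - r)) + mu2 D)%E).
  apply: leeD2r; apply: (@le_trans _ _ (mu2 (A `|` closed_disk c (r0 - r)))).
    apply: le_measure; rewrite ?inE//; first exact: measurable_disk.
    by apply: measurableU => //; exact: measurable_closed_disk.
  by apply: measureU2 => //; exact: measurable_closed_disk.
rewrite addeAC EFinD; apply: leeD; last first.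
  by apply: plane_measure_closed_disk_le; rewrite subr_ge0 ltW.
by apply: le_trans AD_le; rewrite measureU//; exact/disj_set2P.
Qed.

(** The annulus alone, with [D] empty, gives [4 pi r0 r <= 2 r L]; the choice [r = r0 / 2] is
    arbitrary. *)
Lemma perimeter_ge_circle c : closed_disk c r0 `\` disk c r0 `<=` K ->
  2 * pi * r0 <= L.
Proof.
move=> cK; have r_gt0 : 0 < r0 / 2 by rewrite divr_gt0.
have rr0 : r0 / 2 < r0 by rewrite ltr_pdivrMr// ltr_pMr// ltr1n.
have := perimeter_ge_annulus cK r_gt0 rr0 measurable0.
rewrite measure0 adde0 lee_fin => /(_ _ _)-H.
have {}H := H (fun p => False_ind _) (fun p => False_ind _).
by rewrite -(ler_pM2r r_gt0); have := pi_gt0 R; move: H; nra.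
Qed.

(** A point [q] of the curve off the circle contributes a disk of extra centers around it, and its
    area [pi r^2] contradicts the equality. *)
Lemma curve_sub_circle c : closed_disk c r0 `\` disk c r0 `<=` K ->
  L = 2 * pi * r0 -> K `<=` closed_disk c r0 `\` disk c r0.
Proof.
move=> cK LE q Kq; apply: contrapT => qc.
have d_gt0 : 0 < `|enorm (q - c) - r0|.
  rewrite normr_gt0 subr_eq0; apply/eqP => qr; apply: qc.
  by rewrite /disk/closed_disk/= qr lexx ltxx.
(* Half the distance from [q] to the circle keeps the disk around [q] out of the annulus of
   half-width [r]. *)
pose r := Num.min (r0 / 2) (`|enorm (q - c) - r0| / 2).
have r_gt0 : 0 < r by rewrite lt_min !divr_gt0.
have rr0 : r < r0.
  by rewrite gt_min ltr_pdivrMr// ltr_pMr// ltr1n.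
have rd : r * 2 <= `|enorm (q - c) - r0|.
  by rewrite -ler_pdivlMr// ge_min lexx orbT.
have := @perimeter_ge_annulus c r _ cK r_gt0 rr0 (measurable_disk q r).
rewrite plane_measure_disk ?(ltW r_gt0)// -EFinD lee_fin LE => H.
have : pi * (r0 + r) ^+ 2 + pi * r ^+ 2 <= 2 * r * (2 * pi * r0) + pi * (r0 - r) ^+ 2.
  apply: H => [p pq|p pq].
    by exists q.
  move=> pc.
  have := ler_enorm_distD p q c; have := ler_enorm_distD q p c.
  rewrite [enorm (q - p)]enorm_distC; move: pq pc; rewrite /disk/= => pq /andP[pc1 pc2] h1 h2.
  have : `|enorm (q - c) - r0| < r * 2 by rewrite ltr_norml; lra.
  by rewrite ltNge rd.
rewrite leNgt => /negP; apply; rewrite -subr_gt0 (_ : _ - _ = pi * r ^+ 2).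
  by rewrite mulr_gt0 ?pi_gt0// exprn_gt0.
by ring.
Qed.

(** Near a point [q] of the circle off the curve, the region would extend past the inscribed disk
    and contain a small disk disjoint from it, so its area would exceed [pi r0^2]. *)
Lemma circle_sub_curve c : disk c r0 `<=` region U ->
  closed_disk c r0 `\` disk c r0 `<=` K.
Proof.
move=> cU q [qc /negP]; rewrite /closed_disk/disk/= -leNgt => qc'.
have {qc qc'}qr : enorm (q - c) = r0 by apply/eqP; rewrite eq_le qc' qc.
apply: contrapT => Kq.
have [e e_gt0 qe] := disk_avoiding closed_curve Kq.
have pointE (k : R) : let z := (c.1 + k * (q - c).1, c.2 + k * (q - c).2) in
    enorm (z - c) = `|k| * r0 /\ enorm (z - q) = `|k - 1| * r0.
  split; rewrite -qr -enormZ; congr enorm; rewrite /=.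
    by congr pair => /=; ring.
  by case: (q) => x y; congr pair => /=; ring.
(* Points at distance [d] from [q] are taken on the ray from [c] through [q]: one inside the circle,
   which shows that [disk q e] lies in the region, and one outside, around which a disk of radius
   [d] still fits in [disk q e]. *)
pose d := Num.min (e / 2) (r0 / 2).
have d_gt0 : 0 < d by rewrite lt_min !divr_gt0.
have d_e : d <= e / 2 by rewrite ge_min lexx.
have d_r0 : d <= r0 / 2 by rewrite ge_min lexx orbT.
have qU : disk q e `<=` region U.
  have [zc zq] := pointE (1 - d / r0).
  set z := (_, _) in zc zq.
  have dr : 0 < d / r0 < 1.
    by rewrite divr_gt0//= ltr_pdivrMr// mul1r; lra.
  apply: (@filled_disk _ K q e z) => //.
    rewrite /disk/= zq addrAC subrr add0r normrN gtr0_norm ?divr_gt0//.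
    by rewrite divfK ?gt_eqF//; lra.
  apply: cU; rewrite /disk/= zc gtr0_norm; last by rewrite subr_gt0; case/andP: dr.
  by rewrite mulrBl divfK ?gt_eqF//; lra.
have [zc zq] := pointE (1 + d / r0).
set z := (_, _) in zc zq.
have {}zc : enorm (z - c) = r0 + d.
  by rewrite zc gtr0_norm ?addr_gt0 ?divr_gt0// mulrDl mul1r divfK// gt_eqF.
have {}zq : enorm (z - q) = d.
  by rewrite zq addrAC subrr add0r gtr0_norm ?divr_gt0// divfK// gt_eqF.
(* The centers are [r0 + d] apart, so the disks are externally tangent. *)
have disj : [disjoint disk c r0 & disk z d].
  apply/disj_setPS => p []; rewrite /disk/= => pc pz.
  by have := ler_enorm_distD p z c; rewrite zc [enorm (z - p)]enorm_distC; lra.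
have : (mu2 (disk c r0 `|` disk z d) <= mu2 (region U))%E.
  apply: le_measure; rewrite ?inE.
  - by apply: measurableU; exact: measurable_disk.
  - exact: measurable_region.
  - move=> p [/cU//|pz]; apply: qU; move: pz; rewrite /disk/= => pz.
    by have := ler_enorm_distD z p q; rewrite zq; lra.
rewrite measureU; [|exact: measurable_disk|exact: measurable_disk|exact/disj_set2P].
rewrite plane_measure_region areaE [X in (X + _)%E]plane_measure_disk ?(ltW r0_gt0)//.
rewrite [X in (_ + X)%E]plane_measure_disk ?(ltW d_gt0)// -EFinD lee_fin gerDl leNgt.
by rewrite mulr_gt0 ?pi_gt0// exprn_gt0.
Qed.

(** Centers of disks with radii tending to [r0] have a cluster point by compactness, and it serves
    as the center for [r0]. *)
Lemma exists_max_disk : (forall r, 0 < r -> r < r0 -> exists c, disk c r `<=` region U) ->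
  exists c, disk c r0 `<=` region U.
Proof.
move=> Hr; pose rad (n : nat) : R := r0 * (1 - n.+2%:R^-1).
have rad_itv n : 0 < rad n < r0.
  rewrite /rad mulr_gt0 ?subr_gt0 ?invf_lt1 ?ltr1n//=.
  by rewrite gtr_pMr// gtrBl invr_gt0.
have /choice[c cU] : forall n, exists c, disk c (rad n) `<=` region U.
  by move=> n; case/andP: (rad_itv n) => /Hr/[apply].
have L0 := ltW perimeter_gt0.
pose B : set (R * R) := `[(g a).1 - L, (g a).1 + L]%classic `*`
  `[(g a).2 - L, (g a).2 + L]%classic.
have cptB : compact B by apply: compact_setX; exact: segment_compact.
have cB n : B (c n).
  have : region U (c n) by apply: (cU n); apply: disk_center; case/andP: (rad_itv n).
  move=> /(region_sub_closed_disk L0 curve_sub_closed_disk).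
  by move=> /ler_coord_enorm[/=]; rewrite /B/= !in_itv/= !ler_norml; lra.
have [|p [_ clp]] := cptB (c @ \oo) _.
  by exists 0%N => // n _; exact: cB.
exists p => q; rewrite /disk/= => pq.
(* Some center [c n] is within [e] of [p] and has [rad n > r0 - e], so [q] is at distance less than
   [|q - p| + e = r0 - e] from it. *)
pose e := (r0 - enorm (q - p)) / 2.
have e_gt0 : 0 < e by rewrite divr_gt0// subr_gt0.
have [m me] : exists m : nat, r0 * m.+2%:R^-1 < e.
  have [m me] := ltr_add_invr (divr_gt0 e_gt0 r0_gt0); rewrite add0r in me.
  exists m; rewrite mulrC -ltr_pdivlMr//; apply: lt_trans me.
  by rewrite ltf_pV2 ?posrE// ltr_nat.
have [] := clp [set c n | n in [set n | (m <= n)%N]] (disk p e).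
- by exists m => // n /= mn; exists n.
- by apply: open_nbhs_nbhs; split; [exact: open_disk|exact: disk_center].
move=> _ [[n /= mn <-]]; rewrite /disk/= => cp; apply: (cU n); rewrite /disk/=.
have := ler_enorm_distD p q (c n); rewrite [enorm (p - _)]enorm_distC.
have : rad m <= rad n.
  by rewrite ler_pM2l// lerD2l lerN2 lef_pV2 ?posrE// ler_nat.
rewrite {1}/rad mulrBr mulr1; move: me cp; rewrite /e.
by move: (r0 * m.+2%:R^-1) (rad n) => x y; lra.
Qed.

Lemma isoperimetric : 2 * pi * r0 <= L /\
  (L = 2 * pi * r0 -> exists c, K = closed_disk c r0 `\` disk c r0).
Proof.
have pi_gt0 := pi_gt0 R.
have [[r [r_gt0 rr0 no_disk]]|Hr] := pselect (exists r, [/\ 0 < r, r < r0 &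
    forall c, ~ disk c r `<=` region U]).
  have no_out c : ~ K `<=` closed_disk c r.
    move=> Kc; have := area_le_disk (ltW r_gt0) Kc.
    rewrite areaE ler_pM2l// ler_pXn2r ?nnegrE ?(ltW r_gt0) ?(ltW r0_gt0)//.
    by rewrite leNgt rr0.
  have H := perimeter_ge_thickening r_gt0 no_disk no_out.
  (* As [(r0 + r)^2 = 4 r0 r + (r0 - r)^2], this term makes the inequality strict, which excludes
     equality in this case. *)
  have H0 : 0 < pi * (r0 - r) ^+ 2 by rewrite mulr_gt0// exprn_gt0// subr_gt0.
  have : 2 * pi * r0 < L by rewrite -(ltr_pM2l r_gt0); nra.
  by move=> LL; split; [exact: ltW|move=> LE; rewrite LE ltxx in LL].
have [c /circle_sub_curve cK] : exists c, disk c r0 `<=` region U.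
  apply: exists_max_disk => r r_gt0 rr0; apply: contrapT => nc; apply: Hr.
  by exists r; split=> // c cU; apply: nc; exists c.
split; first exact: perimeter_ge_circle cK.
by move=> LE; exists c; apply/seteqP; split=> //; exact: curve_sub_circle.
Qed.

End Isoperimetry.

(** * Rigid motions and unit shapes *)

Section UnitShapes.
Context {R : realType}.
Implicit Types (U : plane_shape R) (p q c : R * R).

Lemma rigid_motion_enorm (M : R * R -> R * R) p q : rigid_motion M ->
  enorm (M p - M q) = enorm (p - q).
Proof.
have rotE theta z w : enorm (rotation theta z - rotation theta w) = enorm (z - w).
  rewrite /enorm/rotation/=; congr Num.sqrt; have := cos2Dsin2 theta.
  move: (cos theta) (sin theta) => k s ks.
  transitivity ((k ^+ 2 + s ^+ 2) * ((z.1 - w.1) ^+ 2 + (z.2 - w.2) ^+ 2)); first by ring.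
  by rewrite ks mul1r.
have reflE phi z w : enorm (reflection phi z - reflection phi w) = enorm (z - w).
  rewrite /enorm/reflection/=; congr Num.sqrt; have := cos2Dsin2 (2 * phi).
  move: (cos (2 * phi)) (sin (2 * phi)) => k s ks.
  transitivity ((k ^+ 2 + s ^+ 2) * ((z.1 - w.1) ^+ 2 + (z.2 - w.2) ^+ 2)); first by ring.
  by rewrite ks mul1r.
have trE v z w : translation v z - translation v w = z - w.
  by rewrite /translation opprD addrACA subrr addr0.
by move=> [theta [v [->|[phi ->]]]] /=; rewrite trE ?reflE rotE.
Qed.

Lemma rigid_motion_surj (M : R * R -> R * R) q : rigid_motion M -> exists p, M p = q.
Proof.
have rot_surj (theta : R) (z : R * R) : exists w, rotation theta w = z.
  exists (rotation (- theta) z); rewrite /rotation cosN sinN; have := cos2Dsin2 theta.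
  move: (cos theta) (sin theta) => k s ks; case: z => x y; congr pair => /=.
    by transitivity ((k ^+ 2 + s ^+ 2) * x); [ring|rewrite ks mul1r].
  by transitivity ((k ^+ 2 + s ^+ 2) * y); [ring|rewrite ks mul1r].
have refl_surj (phi : R) (z : R * R) : exists w, reflection phi w = z.
  exists (reflection phi z); rewrite /reflection; have := cos2Dsin2 (2 * phi).
  move: (cos (2 * phi)) (sin (2 * phi)) => k s ks; case: z => x y; congr pair => /=.
    by transitivity ((k ^+ 2 + s ^+ 2) * x); [ring|rewrite ks mul1r].
  by transitivity ((k ^+ 2 + s ^+ 2) * y); [ring|rewrite ks mul1r].
have tr_surj (v z : R * R) : exists w, translation v w = z.
  by exists (z - v); rewrite /translation subrK.
move=> [theta [v [->|[phi ->]]]] /=; have [p1 <-] := tr_surj v q.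
  by have [p2 <-] := rot_surj theta p1; exists p2.
have [p2 <-] := refl_surj phi p1.
by have [p3 <-] := rot_surj theta p2; exists p3.
Qed.

Lemma unit_circleE : unit_circle R = closed_disk 0 1 `\` disk 0 1.
Proof.
apply/seteqP; split => p; rewrite /unit_circle/closed_disk/disk/= subr0.
  by move=> pE; rewrite /enorm pE sqrtr1 lexx ltxx.
move=> [p1 /negP]; rewrite -leNgt => p2.
by rewrite -sqr_enorm (_ : enorm p = 1) ?expr1n//; apply/eqP; rewrite eq_le p1.
Qed.

(** The center is a preimage of the origin, and rigid motions preserve distances. The inclusion will
    bound the enclosed area from above. *)
Lemma congruent_unit_circle (A : set (R * R)) :
  congruent A (unit_circle R) -> exists c, A `<=` closed_disk c 1.
Proof.
move=> [M HM cM]; have [c Mc] := rigid_motion_surj 0 HM; exists c => p Ap.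
have : unit_circle R (M p) by rewrite cM; exists p.
rewrite unit_circleE => -[+ _]; rewrite /closed_disk/= subr0.
by rewrite -(rigid_motion_enorm p c HM) Mc subr0.
Qed.

Lemma circle_congruent c :
  congruent (closed_disk c 1 `\` disk c 1) (unit_circle R).
Proof.
exists (translation (- c) \o rotation 0); first by exists 0, (- c); left.
have rot0 p : rotation 0 p = p.
  by rewrite /rotation cos0 sin0 !mul1r !mul0r subr0 add0r; case: p.
rewrite unit_circleE; apply/seteqP; split => [p pc|_ [p pc <-]].
  exists (p + c); last by rewrite /= rot0 /translation addrK.
  by move: pc; rewrite /closed_disk/disk/= subr0 addrK.
by move: pc; rewrite /closed_disk/disk/= rot0 /translation subr0.
Qed.

End UnitShapes.

Theorem theorem5p2 (R : realType) (U : plane_shape R) (hU : unit_shape U) :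
  pi <= fundamental_measure U /\
  (pi = fundamental_measure U <-> congruent (curve U) (unit_circle R)).
Proof.
have pi_gt0 := pi_gt0 R; have pi0 : pi != 0 :> R by rewrite gt_eqF.
have LE : perimeter U = 2 * area U.
  by rewrite hU /semiperimeter mulrC divfK// pnatr_eq0.
have area_gt0 : 0 < area U by have := perimeter_gt0 U; rewrite LE pmulr_rgt0.
(* The radius of the disk with the area of the region. *)
pose r0 := Num.sqrt (area U / pi).
have r0_gt0 : 0 < r0 by rewrite sqrtr_gt0 divr_gt0.
have areaE : area U = pi * r0 ^+ 2.
  by rewrite /r0 sqr_sqrtr ?divr_ge0 ?ltW// mulrC divfK.
have [ineq eqcase] := isoperimetric r0_gt0 areaE.
have r0_ge1 : 1 <= r0.
  have : (pi * r0) * 1 <= (pi * r0) * r0 by move: ineq; rewrite LE areaE; lra.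
  by rewrite ler_pM2l// mulr_gt0.
have pi_le : pi <= area U.
  by rewrite areaE -[leLHS]mulr1 ler_pM2l// exprn_ege1.
split=> //; rewrite /fundamental_measure; split => [piE|/congruent_unit_circle[c Kc]].
  (* Area [pi] means [r0 = 1] and perimeter [2 pi], the equality case. *)
  have r01 : r0 = 1 by rewrite /r0 -piE divff// sqrtr1.
  have [|c ->] := eqcase; first by rewrite LE -piE r01 mulr1.
  by rewrite r01; exact: circle_congruent.
(* Conversely the curve lies in a closed disk of radius 1, so its area is at most [pi]. *)
apply/eqP; rewrite eq_le pi_le /=.
by have := area_le_disk ler01 Kc; rewrite expr1n mulr1.
Qed.
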